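(* Let $n>2$, let $p=\frac{n}{n-1}$ and let $f,u_0\in L^1_{\mathrm{loc}}(\mathbb{R}^n)$ with $u_0\ge 0$. Let $X=(X_1,\dots,X_m)$ be real $C^\infty$ vector fields on $\mathbb{R}^n$, $X_k=\sum_{i=1}^n a_{k,i}\frac{\partial}{\partial x_i}$. If $\int_{\mathbb{R}^n}f(x)\,dx>0$ and the functions $a_{k,i}$ and $\frac{\partial a_{k,j}}{\partial x_i}$ are bounded on $\mathbb{R}^n$ for every $1\le k\le m$ and $1\le i,j\le n$, then the problem $u_t-\Delta_X u=|u|^p+f(x)$ in $(0,\infty)\times\mathbb{R}^n$, $u(0,x)=u_0(x)$, does not admit a global in time weak solution.
   Context: For $X_k=\sum_{i=1}^n a_{k,i}\frac{\partial}{\partial x_i}$ put $\operatorname{div}X_k=\sum_{i}\frac{\partial a_{k,i}}{\partial x_i}$, $X_k^\ast=-X_k-\operatorname{div}X_k$ and $\Delta_X=-\sum_{k=1}^m X_k^\ast X_k=\sum_{k=1}^m\bigl(X_k^2+(\operatorname{div}X_k)X_k\bigr)$. Weak solution: for $f,u_0\in L^1_{\mathrm{loc}}(\mathbb{R}^n)$, a function $u\in L^p_{\mathrm{loc}}((0,T),L^p_{\mathrm{loc}}(\mathbb{R}^n))$ is a local in time weak solution (on $[0,T)$) of $u_t-\Delta_X u=|u|^p+f(x)$, $u(0,x)=u_0(x)$, if for every non-negative test function $\psi\in C^1_c([0,T);C^2_c(\mathbb{R}^n))$ one has $\int_0^T\!\int_{\mathbb{R}^n}|u|^p\psi+\int_{\mathbb{R}^n}u_0\psi(0,x)+\int_0^T\!\int_{\mathbb{R}^n}f\psi+\int_0^T\!\int_{\mathbb{R}^n}u\psi_t+\int_0^T\!\int_{\mathbb{R}^n}u\,\Delta_X\psi=0$.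 When $T=\infty$, such $u$ is called a global in time weak solution. *)

(* Defs.v *)
From HB Require Import structures.
From mathcomp Require Import all_boot all_order all_algebra.
From mathcomp Require Import all_classical all_reals all_analysis.

Set Implicit Arguments.
Unset Strict Implicit.
Unset Printing Implicit Defensive.

Import Order.TTheory GRing.Theory Num.Theory.
Import numFieldNormedType.Exports.

Local Open Scope classical_set_scope.
Local Open Scope ring_scope.

(* The sigma-algebra on R^n is generated by the coordinates, as the library
   does for tuples; as R is second countable, it is the Borel sigma-algebra.
   Elements of L^1_loc and L^p_loc below are given by Borel representatives. *)
Definition rV_display : measure_display -> measure_display.
Proof. exact. Qed.

Section measurable_rV.
Context {R : realType} (n : nat).

Let coord (i : 'I_n) (x : 'rV[R]_n) : R := x ord0 i.

Let rV_set0 : g_sigma_preimage coord set0.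
Proof. exact: sigma_algebra0. Qed.

Let rV_setC A : g_sigma_preimage coord A -> g_sigma_preimage coord (~` A).
Proof. exact: sigma_algebraC. Qed.

Let rV_bigcup (F : (set 'rV[R]_n)^nat) :
  (forall i, g_sigma_preimage coord (F i)) ->
  g_sigma_preimage coord (\bigcup_i (F i)).
Proof. exact: sigma_algebra_bigcup. Qed.

HB.instance Definition _ := @isMeasurable.Build
  (rV_display default_measure_display) 'rV[R]_n
  (g_sigma_preimage coord) rV_set0 rV_setC rV_bigcup.

Lemma measurable_coord_rV (i : 'I_n) :
  measurable_fun setT (fun x : 'rV[R]_n => x ord0 i).
Proof.
move=> _ Y mY; rewrite setTI; apply: sub_sigma_algebra => /=.
rewrite -bigcup_seq/=; exists i => /=; first by rewrite mem_index_enum.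
by exists Y => //; rewrite setTI.
Qed.

Lemma measurable_fun_rV d (T : measurableType d) (f : T -> 'rV[R]_n) :
  (forall i, measurable_fun setT (fun t => f t ord0 i)) ->
  measurable_fun setT f.
Proof.
move=> mf _ A mA; rewrite setTI.
suff : g_sigma_preimage coord `<=` [set B | measurable (f @^-1` B)] by apply.
apply: smallest_sub; last first.
  move=> B; rewrite -bigcup_seq => -[i _ [C mC <-]] /=.
  by have := mf i measurableT C mC; rewrite !setTI.
split => /= [|B mB|F mF].
- by rewrite preimage_set0.
- by rewrite setTD preimage_setC; exact: measurableC.
- by rewrite preimage_bigcup; exact: bigcup_measurable.
Qed.

End measurable_rV.

(* Lebesgue measure on R^n, by iterated products along R^(n+1) = R * R^n;
   see lebesgue_rV_box. *)
Section lebesgue_rV.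
Context {R : realType}.
Local Open Scope ereal_scope.

Definition rV_cons n (z : R * 'rV[R]_n) : 'rV[R]_n.+1 :=
  row_mx z.1%:M z.2.

Lemma rV_cons_ord0 n (z : R * 'rV[R]_n) : rV_cons z ord0 ord0 = z.1.
Proof.
rewrite (_ : ord0 = @lshift 1 n ord0 :> 'I_(1 + n)); last exact: val_inj.
by rewrite (@row_mxEl _ 1 1 n) mxE eqxx.
Qed.

Lemma rV_cons_lift n (z : R * 'rV[R]_n) j :
  rV_cons z ord0 (lift ord0 j) = z.2 ord0 j.
Proof.
rewrite (_ : lift ord0 j = @rshift 1 n j :> 'I_(1 + n)); last exact: val_inj.
by rewrite (@row_mxEr _ 1 1 n).
Qed.

Fixpoint lebesgue_rV n : set 'rV[R]_n -> \bar R :=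
  match n with
  | 0 => \d_(0%R : 'rV[R]_0)
  | n'.+1 => pushforward (lebesgue_measure \x @lebesgue_rV n') (@rV_cons n')
  end.

Lemma measurable_rV_cons n : measurable_fun setT (@rV_cons n).
Proof.
apply: measurable_fun_rV => i; case: (unliftP ord0 i) => [j|] ->.
- under eq_fun do rewrite rV_cons_lift.
  apply: (@measurableT_comp _ _ _ _ _ _ (fun x : 'rV[R]_n => x ord0 j)) => //.
  exact: measurable_coord_rV.
- under eq_fun do rewrite rV_cons_ord0.
  exact: measurable_fst.
Qed.

Section lebesgue_rV_step.
Variables (n : nat) (m : {sigma_finite_measure set 'rV[R]_n -> \bar R}).

Local Notation mu := (lebesgue_measure \x m).
Definition lebesgue_rV_step := pushforward mu (@rV_cons n).
Local Notation nu := lebesgue_rV_step.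

Let mpre A : measurable A -> measurable (@rV_cons n @^-1` A).
Proof.
by move=> mA; have := measurable_rV_cons measurableT mA; rewrite setTI.
Qed.

Let nu0 : nu set0 = 0.
Proof. by rewrite /lebesgue_rV_step /pushforward preimage_set0 measure0. Qed.

Let nu_ge0 A : 0 <= nu A.
Proof. by rewrite /lebesgue_rV_step /pushforward measure_ge0. Qed.

Let nu_sigma_additive : semi_sigma_additive nu.
Proof.
move=> F mF tF mUF; rewrite /lebesgue_rV_step /pushforward preimage_bigcup.
apply: measure_semi_sigma_additive => [k||].
- exact: mpre.
- apply/trivIsetP => /= i j _ _ ij; rewrite -preimage_setI.
  by move/trivIsetP : tF => /(_ _ _ _ _ ij) ->//; rewrite preimage_set0.
- by rewrite -preimage_bigcup; exact: mpre.
Qed.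

HB.instance Definition _ := isMeasure.Build _ _ _ nu
  nu0 nu_ge0 nu_sigma_additive.

Let rV_uncons (x : 'rV[R]_n.+1) : R * 'rV[R]_n :=
  (x ord0 ord0, \row_j x ord0 (lift ord0 j)).

Let rV_consK z : rV_uncons (rV_cons z) = z.
Proof.
rewrite /rV_uncons rV_cons_ord0; case: z => r v /=; congr pair.
by apply/rowP => j; rewrite mxE rV_cons_lift.
Qed.

Let measurable_rV_uncons : measurable_fun setT rV_uncons.
Proof.
apply/measurable_fun_pairP; split; first exact: measurable_coord_rV.
apply: measurable_fun_rV => i /=.
under eq_fun do rewrite mxE.
exact: measurable_coord_rV.
Qed.

Let nu_sigma_finite : sigma_finite setT nu.
Proof.
have [F [FT Foo]] : exists F : (set (R * 'rV[R]_n))^nat,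
    setT = \bigcup_k F k /\ forall k, measurable (F k) /\ mu (F k) < +oo.
  have /sigma_finiteP[F [TF ndF Foo]] := sigma_finiteT (@lebesgue_measure R).
  have /sigma_finiteP[G [TG ndG Goo]] := sigma_finiteT m.
  exists (fun k => F k `*` G k); split.
    apply/seteqP; split => [[x y] _|//].
    have [i _ Fx] : (\bigcup_k F k) x by rewrite -TF.
    have [j _ Gy] : (\bigcup_k G k) y by rewrite -TG.
    exists (maxn i j) => //; split => /=.
    - by move: x Fx; exact/subsetPset/ndF/leq_maxl.
    - by move: y Gy; exact/subsetPset/ndG/leq_maxr.
  move=> k; have [? ?] := Foo k; have [? ?] := Goo k.
  split; first exact: measurableX.
  by rewrite product_measure1E// lte_mul_pinfty// ge0_fin_numE.
exists (fun k => rV_uncons @^-1` (F k)).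
  by rewrite -preimage_bigcup -FT preimage_setT.
move=> k; have [mF Fk] := Foo k; split.
  by rewrite -[X in measurable X]setTI; exact: measurable_rV_uncons.
rewrite /lebesgue_rV_step /pushforward -comp_preimage.
rewrite (_ : _ \o _ = id) ?preimage_id//.
by apply/funext => z /=; rewrite rV_consK.
Qed.

HB.instance Definition _ := Measure_isSigmaFinite.Build _ _ _ nu
  nu_sigma_finite.

End lebesgue_rV_step.

Let lebesgue_rV_pack n :
  {m : {sigma_finite_measure set 'rV[R]_n -> \bar R} |
    m = @lebesgue_rV n :> (_ -> _)}.
Proof.
elim: n => [|n [m mE]] /=; first by exists (\d_(0%R : 'rV[R]_0)).
by exists (lebesgue_rV_step m); rewrite -mE.
Qed.

Section lebesgue_rV_measure.
Variable n : nat.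

Let lebesgue_rV0 : @lebesgue_rV n set0 = 0.
Proof. by have [m <-] := lebesgue_rV_pack n; exact: measure0. Qed.

Let lebesgue_rV_ge0 (A : set 'rV[R]_n) : 0 <= lebesgue_rV A.
Proof. by have [m <-] := lebesgue_rV_pack n; exact: measure_ge0. Qed.

Let lebesgue_rV_sigma_additive : semi_sigma_additive (@lebesgue_rV n).
Proof.
by have [m <-] := lebesgue_rV_pack n; exact: measure_semi_sigma_additive.
Qed.

HB.instance Definition _ := isMeasure.Build _ _ _ (@lebesgue_rV n)
  lebesgue_rV0 lebesgue_rV_ge0 lebesgue_rV_sigma_additive.

Let lebesgue_rV_sigma_finite : sigma_finite setT (@lebesgue_rV n).
Proof. by have [m <-] := lebesgue_rV_pack n; exact: sigma_finiteT. Qed.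

HB.instance Definition _ := Measure_isSigmaFinite.Build _ _ _ (@lebesgue_rV n)
  lebesgue_rV_sigma_finite.

End lebesgue_rV_measure.

Lemma measurable_rV_box n (D : 'I_n -> set R) :
  (forall i, measurable (D i)) ->
  measurable [set x : 'rV[R]_n | forall i, D i (x ord0 i)].
Proof.
move=> mD; rewrite (_ : mkset _ =
  \bigcap_(i in [set: 'I_n]) ((fun x : 'rV[R]_n => x ord0 i) @^-1` D i)).
  apply: fin_bigcap_measurable => // i _.
  by rewrite -[X in measurable X]setTI; exact: measurable_coord_rV.
by apply/seteqP; split => [x Dx i _|x Dx i]; exact: Dx.
Qed.

Lemma lebesgue_rV_box n (D : 'I_n -> set R) :
  (forall i, measurable (D i)) ->
  lebesgue_rV [set x : 'rV[R]_n | forall i, D i (x ord0 i)] =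
  \prod_(i < n) lebesgue_measure (D i).
Proof.
elim: n D => [|n IH] D mD.
  by rewrite big_ord0 /= diracE mem_set// => -[].
have mD' i : measurable (D (lift ord0 i)) by [].
rewrite big_ord_recl -IH//= /pushforward.
have := @product_measure1E _ _ _ _ R (@lebesgue_measure R) (@lebesgue_rV n)
  _ _ (mD ord0) (measurable_rV_box mD').
move=> /= <-.
congr (_ _); apply/seteqP; split => -[r v] /=.
  move=> Dx; split => [|i]; first by have := Dx ord0; rewrite rV_cons_ord0.
  by have := Dx (lift ord0 i); rewrite rV_cons_lift.
move=> [Dr Dv] i; case: (unliftP ord0 i) => [j|] ->.
  by rewrite rV_cons_lift; exact: Dv.
by rewrite rV_cons_ord0.
Qed.

End lebesgue_rV.

Section vector_fields.
Context {R : realType} {n : nat}.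
Implicit Types (f g : 'rV[R]_n -> R) (a : 'I_n -> 'rV[R]_n -> R).

Definition partial (i : 'I_n) f : 'rV[R]_n -> R :=
  fun x => 'D_(delta_mx ord0 i) f x.

Fixpoint continuously_differentiable (k : nat) f : Prop :=
  continuous f /\
  match k with
  | 0 => True
  | k'.+1 => forall i : 'I_n,
      (forall x, derivable f x (delta_mx ord0 i)) /\
      continuously_differentiable k' (partial i f)
  end.

Definition smooth f : Prop := forall k, continuously_differentiable k f.

Definition vfield a f : 'rV[R]_n -> R :=
  fun x => \sum_(i < n) a i x * partial i f x.

Definition divergence a : 'rV[R]_n -> R :=
  fun x => \sum_(i < n) partial i (a i) x.

Definition vfield_adj a f : 'rV[R]_n -> R :=
  fun x => - vfield a f x - divergence a x * f x.

Definition sublaplacian m (a : 'I_m -> 'I_n -> 'rV[R]_n -> R) f :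
    'rV[R]_n -> R :=
  fun x => - \sum_(k < m) vfield_adj (a k) (vfield (a k) f) x.

End vector_fields.

Section test_functions.
Context {R : realType} {n : nat}.
Implicit Types (K : set 'rV[R]_n) (g : 'rV[R]_n -> R) (T : \bar R).

Definition C2_supported K g : Prop :=
  continuously_differentiable 2 g /\ forall x, ~ K x -> g x = 0.

(* The C^2 norm of g, the largest sup norm of its partial derivatives of order
   at most 2, is at most e. *)
Definition C2_norm_le (e : R) g : Prop :=
  forall x, [/\ `|g x| <= e, forall i, `|partial i g x| <= e &
                forall i j, `|partial i (partial j g) x| <= e].

Definition Ico0 T : set R := [set t | 0 <= t /\ (t%:E < T)%E].
Definition Ioo0 T : set R := [set t | 0 < t /\ (t%:E < T)%E].

(* psi : [0, T) -> C^2_c(R^n) is a C^1 curve with compact support in time; its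
   values outside [0, T) are irrelevant. Such a curve lives in the Banach space
   of C^2 functions supported in one compact set K (compact subsets of the
   strict inductive limit C^2_c are contained in a step), so that the curve
   dpsi of its derivatives, one-sided at 0, is taken in the C^2 norm. *)
Definition C1c_C2c T (psi : R -> 'rV[R]_n -> R) : Prop :=
  exists (K : set 'rV[R]_n) (b : R) (dpsi : R -> 'rV[R]_n -> R),
  [/\ compact K /\ (b%:E < T)%E,
      forall t, Ico0 T t -> C2_supported K (psi t) /\ C2_supported K (dpsi t),
      forall t, Ico0 T t -> b < t -> psi t = (fun=> 0),
      forall t, Ico0 T t -> forall e, 0 < e -> \forall s \near t^',
        Ico0 T s ->
        C2_norm_le e (fun x => (s - t)^-1 * (psi s x - psi t x) - dpsi t x) &
      forall t, Ico0 T t -> forall e, 0 < e -> \forall s \near t,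
        Ico0 T s -> C2_norm_le e (fun x => dpsi s x - dpsi t x)].

End test_functions.

Section weak_solutions.
Context {R : realType} {n : nat}.
Implicit Types (f g : 'rV[R]_n -> R) (T : \bar R) (u : R -> 'rV[R]_n -> R).
Local Notation dt := (@lebesgue_measure R).
Local Notation dx := (@lebesgue_rV R n).
Local Open Scope ereal_scope.

Definition L1loc g : Prop :=
  measurable_fun setT g /\
  forall K : set 'rV[R]_n, compact K -> \int[dx]_(x in K) `|g x|%:E < +oo.

(* A (strongly measurable) function from (0, T) to L^p_loc(R^n) is represented
   by a jointly measurable function of t and x. *)
Definition Lploc_Lploc (p : R) T u : Prop :=
  measurable_fun (Ioo0 T `*` [set: 'rV[R]_n]) (fun z => u z.1 z.2) /\
  forall (J : set R) (K : set 'rV[R]_n),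
    compact J -> J `<=` Ioo0 T -> compact K ->
    \int[dt]_(t in J) \int[dx]_(x in K) (`|u t x| `^ p)%:E < +oo.

(* The identity is stated in the extended reals, where +oo - +oo = -oo, both
   for sums and for the positive and negative parts of an integrand. Hence
   it can only hold if all five terms are finite. *)
Definition weak_solution m (a : 'I_m -> 'I_n -> 'rV[R]_n -> R) (p : R)
    (f u0 : 'rV[R]_n -> R) T u : Prop :=
  Lploc_Lploc p T u /\
  forall psi : R -> 'rV[R]_n -> R, C1c_C2c T psi ->
    (forall t x, Ico0 T t -> (0 <= psi t x)%R) ->
    \int[dt]_(t in Ioo0 T) \int[dx]_x (`|u t x| `^ p * psi t x)%:E
    + \int[dx]_x (u0 x * psi 0%R x)%:E
    + \int[dt]_(t in Ioo0 T) \int[dx]_x (f x * psi t x)%:E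
    + \int[dt]_(t in Ioo0 T) \int[dx]_x (u t x * derive1 (psi ^~ x) t)%:E
    + \int[dt]_(t in Ioo0 T) \int[dx]_x (u t x * sublaplacian a (psi t) x)%:E
    = 0.

Definition global_weak_solution m (a : 'I_m -> 'I_n -> 'rV[R]_n -> R) (p : R)
    (f u0 : 'rV[R]_n -> R) u : Prop :=
  weak_solution a p f u0 +oo u.

End weak_solutions.

(* Main.v *)
(* Test-function method in the critical case. With q = 2n and s_+ = max(s, 0),
   test the equation against
     psi(t, x) = (1 - t / T)_+ ^ q * (w x)_+ ^ q,
     w x = 1 - ln (1 + |x|^2) / (N + 1).
   The logarithmic cut-off makes |Delta_X psi| at most
     C (N + 1)^-1 (1 + |x|^2)^(-1/2) ((1 - t / T)_+ (w x)_+) ^ (q - 2),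
   the first-order part of Delta_X being the one that decays slowest. As the
   conjugate exponent of p is n and (q - 2) p = q, Young's inequality absorbs
   the terms in u up to the integrals of the n-th powers of the coefficients:
   O(T^(1 - n)) for fixed N from psi_t, and, the integral of
   (1 + |x|^2)^(-n/2) over {w > 0} being O(N + 1), only T * O((N + 1)^(1 - n))
   from Delta_X psi. The forcing term is at least c T with c > 0 independent of
   N and T, hence a contradiction for N large and then T large. *)
Require Import Defs.
From mathcomp Require Import all_boot all_order all_algebra.
From mathcomp Require Import all_classical all_reals all_analysis.
From mathcomp Require Import measurable_realfun zify ring lra.

Set Implicit Arguments.
Unset Strict Implicit.
Unset Printing Implicit Defensive.

Import Order.TTheory GRing.Theory Num.Theory.
Import numFieldNormedType.Exports.

Local Open Scope classical_set_scope.
Local Open Scope ring_scope.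

(** * Powers of the positive part *)

Section pospow.
Context {R : realType}.
Implicit Types (t h : R) (k : nat).

(** At exponent 0 this is the constant 1, also for negative [t]; hence vanishing on the negative
    axis is stated for successor exponents only. *)
Definition pospow k t : R := Num.max 0 t ^+ k.

Lemma pospow_ge0 k t : 0 <= pospow k t.
Proof. by rewrite exprn_ge0// le_max lexx. Qed.

Lemma pospow_eq0 k t : t <= 0 -> pospow k.+1 t = 0.
Proof. by move=> t0; rewrite /pospow max_l// expr0n. Qed.

Lemma pospowE k t : 0 <= t -> pospow k t = t ^+ k.
Proof. by move=> t0; rewrite /pospow max_r. Qed.

Lemma pospow_le1 k t : t <= 1 -> pospow k t <= 1.
Proof. by move=> t1; rewrite exprn_ile1// ?ge_max ?ler01 // le_max lexx. Qed.

Lemma le_pospow k : {homo pospow k : s t / s <= t}.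
Proof.
move=> s t st; have ge0 (r : R) : 0 <= Num.max 0 r by rewrite le_max lexx.
by rewrite /pospow lerXn2r ?nnegrE// ge_max ge0 le_max st orbT.
Qed.

Lemma ler_pospow k l t : t <= 1 -> (k <= l)%N -> pospow l t <= pospow k t.
Proof.
by move=> t1 kl; apply: ler_wiXn2l; rewrite ?le_max ?lexx// ge_max ler01.
Qed.

(** Exponents start at 2 because [pospow 1 t = t * pospow 0 t] fails for negative [t]. With the
    product rule, this recursion yields all derivatives from that of the square. *)
Lemma pospowS k t : pospow k.+2 t = t * pospow k.+1 t.
Proof.
have [t0|t0] := leP t 0; first by rewrite !pospow_eq0// mulr0.
by rewrite !pospowE ?ltW// exprS.
Qed.

Lemma continuous_pospow k : continuous (pospow k).
Proof.
move=> t; apply: (@continuous_comp R R R (Num.max 0) (fun s : R => s ^+ k)).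
  by apply: continuous_max => ?; [exact: cvg_cst|exact: cvg_id].
exact: exprn_continuous.
Qed.

(** The difference quotient differs from the claimed derivative by at most [|h|], as the four sign
    cases of [t] and of the shifted point show after multiplication by [|h|]. *)
Let is_derive_pospow2 t : is_derive t 1 (pospow 2) (2 * pospow 1 t).
Proof.
suff H : (fun h => h^-1 *: ((pospow 2 \o shift t) (h *: 1) - pospow 2 t))
    @ 0^' --> 2 * pospow 1 t.
  by split; [apply/cvg_ex; eexists; exact: H|exact/cvg_lim].
apply/cvgrPdist_le => /= e e0; near=> h.
have h0 : h != 0 by near: h; exact: nbhs_dnbhs_neq.
apply: (@le_trans _ _ `|h|); last first.
  by near: h; apply: dnbhs0_le.
rewrite [h *: 1]mulr1 -(ler_pM2l (_ : 0 < `|h|)) ?normr_gt0//.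
rewrite -normrM mulrBr [X in _ - X]mulrA mulfV// mul1r -expr2 real_normK ?num_real//.
rewrite /pospow expr1 !maxEle.
by case: ifP => ht; case: ifP => t0; apply/ler_normlP; split;
  move: ht t0 => /[dup]; move=> /negP; nra.
Unshelve. all: by end_near. Qed.

Lemma is_derive_pospow k t :
  is_derive t 1 (pospow k.+2) (k.+2%:R * pospow k.+1 t).
Proof.
elim: k => [//|k IH].
rewrite (_ : pospow k.+3 = id * pospow k.+2); last first.
  by apply/funext => s; rewrite pospowS.
apply: is_derive_eq.
by rewrite /= /GRing.scale/= pospowS !mulr1 -[k.+3]add1n natrD; ring.
Qed.

End pospow.

(** * Rules for continuity and directional derivatives *)

Section continuous_arith.
Context {R : realType} {T : topologicalType}.
Implicit Types f g : T -> R.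

Lemma continuous_add f g :
  continuous f -> continuous g -> continuous (fun x => f x + g x).
Proof. by move=> cf cg x; apply: (continuousD (cf x) (cg x)). Qed.

Lemma continuous_sub f g :
  continuous f -> continuous g -> continuous (fun x => f x - g x).
Proof. by move=> cf cg x; apply: (continuousB (cf x) (cg x)). Qed.

Lemma continuous_mul f g :
  continuous f -> continuous g -> continuous (fun x => f x * g x).
Proof. by move=> cf cg x; apply: (continuousM (cf x) (cg x)). Qed.

Lemma continuous_inv f : (forall x, f x != 0) ->
  continuous f -> continuous (fun x => (f x)^-1).
Proof. by move=> f0 cf x; apply: (continuousV (f0 x) (cf x)). Qed.

End continuous_arith.

Section chain_rule.
Context {R : realType} {V : normedModType R}.
Implicit Types (f : V -> R) (g : R -> R) (x v : V).

(** Restriction to the line through [x] along [v] turns a directional derivative into an ordinary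
    one, which is how the one-variable chain rule is carried over below. *)
Lemma is_derive_line f x v df :
  is_derive x v f df <-> is_derive (0 : R) 1 (fun h : R => f (h *: v + x)) df.
Proof.
have E : 'D_v f x = 'D_1 (fun h : R => f (h *: v + x)) 0.
  apply: (congr1 (fun k : R -> R => lim (k @ 0^'))); apply/funext => h /=.
  by rewrite addr0 scale0r add0r [h *: 1]mulr1.
split=> -[D DE]; split; [exact: (derivable1P f x v).1|by rewrite -DE E| |].
- exact: (derivable1P f x v).2.
- by rewrite E.
Qed.

Lemma is_derive_comp1 f g x v df dg :
  is_derive x v f df -> is_derive (f x) 1 g dg ->
  is_derive x v (g \o f) (dg * df).
Proof.
move=> /is_derive_line Df Dg; apply/is_derive_line.
by apply: is_derive1_comp; rewrite ?scale0r ?add0r.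
Qed.

Lemma is_derive_inv f x v df : f x != 0 -> is_derive x v f df ->
  is_derive x v (fun y => (f y)^-1) (- (f x) ^- 2 * df).
Proof.
by move=> fx0 [Df <-]; split; [exact: derivableV|rewrite deriveV].
Qed.

End chain_rule.

(** * Coordinates and the squared Euclidean norm *)

Section coordinates.
Context {R : realType} {n : nat}.
Implicit Types (x : 'rV[R]_n) (i j : 'I_n) (f : 'rV[R]_n -> R).
Local Notation e i := (delta_mx ord0 i : 'rV[R]_n).

Lemma is_derive_coord x i j :
  is_derive x (e j) (fun y : 'rV[R]_n => y ord0 i) (i == j)%:R.
Proof.
have D : is_derive (0 : R) 1 (fun h : R => h * (i == j)%:R + x ord0 i) (i == j)%:R.
  apply: (@is_derive_eq _ _ _ (id * cst (i == j)%:R + cst (x ord0 i))).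
  by rewrite /= /GRing.scale/= mulr0 add0r addr0 mulr1.
apply/is_derive_line.
rewrite (_ : (fun h => _) = (fun h : R => h * (i == j)%:R + x ord0 i))//.
by apply/funext => h; rewrite !mxE eqxx.
Qed.

Lemma is_derive_partial f i x : derivable f x (e i) ->
  is_derive x (e i) f (partial i f x).
Proof. by move=> ?; exact: derivableP. Qed.

Lemma partialE f df i : (forall x, is_derive x (e i) f (df x)) ->
  partial i f = df.
Proof. by move=> D; apply/funext => x; rewrite /partial derive_val. Qed.

Definition sqnorm x : R := \sum_(i < n) x ord0 i ^+ 2.

Lemma sqnorm_ge0 x : 0 <= sqnorm x.
Proof. by apply: sumr_ge0 => i _; exact: sqr_ge0. Qed.

Lemma ler_sqnorm x i : x ord0 i ^+ 2 <= sqnorm x.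
Proof.
by rewrite /sqnorm (bigD1 i)//= lerDl; apply: sumr_ge0 => j _; exact: sqr_ge0.
Qed.

Lemma sqnorm1_gt0 x : 0 < 1 + sqnorm x.
Proof. by rewrite ltr_wpDr// sqnorm_ge0. Qed.

Lemma is_derive_sqnorm x j : is_derive x (e j) sqnorm (2 * x ord0 j).
Proof.
have D i : is_derive x (e j) ((fun y : 'rV[R]_n => y ord0 i) ^+ 2)
    (2 * x ord0 i * (i == j)%:R).
  have := is_derive_coord x i j => ?.
  by apply: is_derive_eq; rewrite expr1.
have -> : sqnorm = \sum_(i < n) ((fun y : 'rV[R]_n => y ord0 i) ^+ 2).
  by apply/funext => y; rewrite fct_sumE.
apply: is_derive_eq; rewrite (bigD1 j)//= eqxx mulr1 big1 ?addr0// => i /negPf ->.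
by rewrite mulr0.
Qed.

Lemma continuous_coord i : continuous (fun x => x ord0 i).
Proof. exact: coord_continuous. Qed.

Lemma continuous_sqnorm : continuous sqnorm.
Proof.
apply: continuous_big => [|i _ x]; first exact: add_continuous.
apply: (@continuous_comp _ _ _ (fun x : 'rV[R]_n => x ord0 i) (fun s : R => s ^+ 2)).
  exact: continuous_coord.
exact: exprn_continuous.
Qed.

Lemma continuous_inv_sqnorm1 : continuous (fun x => (1 + sqnorm x)^-1).
Proof.
apply: continuous_inv => [x|]; first by rewrite gt_eqF ?sqnorm1_gt0.
by apply: continuous_add; [exact: cst_continuous|exact: continuous_sqnorm].
Qed.

End coordinates.

(** * The logarithmic cut-off in space and its derivatives up to order 2 *)

Section log_cutoff.
Context {R : realType} {n : nat}.
Implicit Types (x : 'rV[R]_n) (i j : 'I_n) (d : R) (k : nat).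
Local Notation e i := (delta_mx ord0 i : 'rV[R]_n).
Local Notation q := (@sqnorm R n).

(** The function w of the overview, with [d] for 1 / (N + 1). For [d > 0] it is positive exactly
    where 1 + |x|^2 < exp (1 / d). *)
Definition logw d x : R := 1 - d * ln (1 + q x).

(** Both orders of derivatives are expressed through x_i / (1 + |x|^2), the quantity whose decay is
    estimated in [norm_coord_inv]. *)
Definition dlogw d i x : R := - (2 * d) * (x ord0 i * (1 + q x)^-1).

Definition ddlogw d i j x : R :=
  - (2 * d) * ((j == i)%:R * (1 + q x)^-1
               - 2 * (x ord0 i * (1 + q x)^-1) * (x ord0 j * (1 + q x)^-1)).

Lemma is_derive_logw d i x : is_derive x (e i) (logw d) (dlogw d i x).
Proof.
have Dq := is_derive_sqnorm x i.
have Dl : is_derive x (e i) (@ln R \o (cst 1 + q)) ((1 + q x)^-1 * (0 + 2 * x ord0 i)).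
  apply: is_derive_comp1; exact: is_derive1_ln (sqnorm1_gt0 x).
rewrite (_ : logw d = cst 1 - d *: (@ln R \o (cst 1 + q)))//.
apply: is_derive_eq.
by rewrite /dlogw /GRing.scale/=; ring.
Qed.

Lemma is_derive_dlogw d i j x :
  is_derive x (e j) (dlogw d i) (ddlogw d i j x).
Proof.
have Dq := is_derive_sqnorm x j.
have Dx := is_derive_coord x i j.
have q0 : 1 + q x != 0 by rewrite gt_eqF ?sqnorm1_gt0.
have Di : is_derive x (e j) (fun y : 'rV[R]_n => (1 + q y)^-1)
    (- (1 + q x) ^- 2 * (0 + 2 * x ord0 j)).
  by apply: (@is_derive_inv _ _ (cst 1 + q)).
rewrite (_ : dlogw d i = - (2 * d) *: ((fun y : 'rV[R]_n => y ord0 i) *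
  (fun y : 'rV[R]_n => (1 + q y)^-1)))//.
apply: is_derive_eq.
by rewrite /ddlogw /GRing.scale/= eq_sym; field.
Qed.

Definition logcut d k x : R := pospow k (logw d x).

(** This and [ddlogcut] are shown to be the partial derivatives for exponents at least 2 and at
    least 3 respectively, where the positive part is raised to a power that is still
    differentiable. *)
Definition dlogcut d k i x : R :=
  k%:R * pospow k.-1 (logw d x) * dlogw d i x.

Definition ddlogcut d k i j x : R :=
  k%:R * (k.-1%:R * pospow k.-2 (logw d x) * dlogw d j x * dlogw d i x
          + pospow k.-1 (logw d x) * ddlogw d i j x).

Lemma is_derive_logcut d k i x :
  is_derive x (e i) (logcut d k.+2) (dlogcut d k.+2 i x).
Proof.
have := is_derive_comp1 (is_derive_logw d i x) (is_derive_pospow k (logw d x)).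
by [].
Qed.

Lemma is_derive_dlogcut d k i j x :
  is_derive x (e j) (dlogcut d k.+3 i) (ddlogcut d k.+3 i j x).
Proof.
have Dw := is_derive_dlogw d i j x.
have Dp := is_derive_logcut d k j x.
rewrite (_ : dlogcut d k.+3 i = k.+3%:R *: (logcut d k.+2 * dlogw d i)); last first.
  by apply/funext => y; rewrite /dlogcut -mulrA.
apply: is_derive_eq.
by rewrite /ddlogcut /dlogcut /logcut /GRing.scale/=; ring.
Qed.

Lemma partial_logcut d k i : partial i (logcut d k.+2) = dlogcut d k.+2 i.
Proof. by apply: partialE => x; exact: is_derive_logcut. Qed.

Lemma partial_dlogcut d k i j :
  partial j (dlogcut d k.+3 i) = ddlogcut d k.+3 i j.
Proof. by apply: partialE => x; exact: is_derive_dlogcut. Qed.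

Lemma continuous_logw d : continuous (logw d).
Proof.
apply: continuous_sub; first exact: cst_continuous.
apply: continuous_mul; first exact: cst_continuous.
move=> x; apply: (@continuous_comp _ _ _ (fun y => 1 + q y) (@ln R)).
  by apply: continuous_add; [exact: cst_continuous|exact: continuous_sqnorm].
exact: continuous_ln (sqnorm1_gt0 x).
Qed.

Lemma continuous_logcut d k : continuous (logcut d k).
Proof.
move=> x; apply: (@continuous_comp _ _ _ (logw d) (pospow k)).
  exact: continuous_logw.
exact: continuous_pospow.
Qed.

Let continuous_coord_inv i :
  continuous (fun x : 'rV[R]_n => x ord0 i * (1 + q x)^-1).
Proof.
by apply: continuous_mul; [exact: continuous_coord|exact: continuous_inv_sqnorm1].
Qed.

Lemma continuous_dlogw d i : continuous (dlogw d i).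
Proof.
by apply: continuous_mul; [exact: cst_continuous|exact: continuous_coord_inv].
Qed.

Lemma continuous_ddlogw d i j : continuous (ddlogw d i j).
Proof.
apply: continuous_mul; first exact: cst_continuous.
apply: continuous_sub.
  apply: continuous_mul; first exact: cst_continuous.
  exact: continuous_inv_sqnorm1.
apply: continuous_mul; last exact: continuous_coord_inv.
by apply: continuous_mul; [exact: cst_continuous|exact: continuous_coord_inv].
Qed.

Lemma continuous_dlogcut d k i : continuous (dlogcut d k i).
Proof.
apply: continuous_mul; last exact: continuous_dlogw.
by apply: continuous_mul; [exact: cst_continuous|exact: continuous_logcut].
Qed.

Lemma continuous_ddlogcut d k i j : continuous (ddlogcut d k i j).
Proof.
apply: continuous_mul; first exact: cst_continuous.
apply: continuous_add.
  apply: continuous_mul; last exact: continuous_dlogw.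
  apply: continuous_mul; last exact: continuous_dlogw.
  by apply: continuous_mul; [exact: cst_continuous|exact: continuous_logcut].
by apply: continuous_mul; [exact: continuous_logcut|exact: continuous_ddlogw].
Qed.

Lemma logw_le1 d x : 0 <= d -> logw d x <= 1.
Proof.
by move=> d0; rewrite gerBl mulr_ge0// ln_ge0// lerDl sqnorm_ge0.
Qed.

(** With s the square root of 1 + |x|^2, the numerator is at most s and the denominator is s^2. *)
Let norm_coord_inv i x :
  `|x ord0 i * (1 + q x)^-1| <= (Num.sqrt (1 + q x))^-1.
Proof.
set s := Num.sqrt _.
have s0 : 0 < s by rewrite sqrtr_gt0 sqnorm1_gt0.
have sE : 1 + q x = s ^+ 2 by rewrite sqr_sqrtr// ltW// sqnorm1_gt0.
have xs : `|x ord0 i| <= s.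
  rewrite -sqrtr_sqr ler_wsqrtr//; apply: (le_trans (ler_sqnorm x i)).
  by rewrite lerDr.
rewrite normrM normfV sE normrX (ger0_norm (ltW s0)) ler_pdivrMr ?exprn_gt0//.
by rewrite expr2 mulrA mulVf ?mul1r// gt_eqF.
Qed.

Let inv_sqrt_le1 x : 0 < (Num.sqrt (1 + q x))^-1 <= 1.
Proof.
rewrite invr_gt0 sqrtr_gt0 sqnorm1_gt0/= invf_le1 ?sqrtr_gt0 ?sqnorm1_gt0//.
by rewrite -[leLHS]sqrtr1 ler_wsqrtr// lerDl sqnorm_ge0.
Qed.

Lemma norm_dlogw d i x : 0 <= d ->
  `|dlogw d i x| <= 2 * d * (Num.sqrt (1 + q x))^-1.
Proof.
move=> d0; rewrite normrM normrN (ger0_norm (_ : 0 <= 2 * d)) ?mulr_ge0//.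
by apply: ler_wpM2l; rewrite ?mulr_ge0// norm_coord_inv.
Qed.

(** The second derivatives decay like the square of s = (1 + |x|^2)^(-1/2); as s <= 1, one factor is
    given up so that both orders share the decay s. The constant is 6 = 2 (1 + 2), one summand for
    each term of [ddlogw]. *)
Lemma norm_ddlogw d i j x : 0 <= d ->
  `|ddlogw d i j x| <= 6 * d * (Num.sqrt (1 + q x))^-1.
Proof.
move=> d0; rewrite normrM normrN (ger0_norm (_ : 0 <= 2 * d)) ?mulr_ge0//.
set s := (Num.sqrt _)^-1.
have /andP[s0 s1] := inv_sqrt_le1 x; rewrite -/s in s0 s1.
have sE : (1 + q x)^-1 = s ^+ 2.
  by rewrite exprVn sqr_sqrtr// ltW// sqnorm1_gt0.
have xi := norm_coord_inv i x; have xj := norm_coord_inv j x.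
rewrite -/s in xi xj.
apply: (@le_trans _ _ (2 * d * (3 * s))); last by lra.
apply: ler_wpM2l; first by rewrite mulr_ge0.
apply: (le_trans (ler_normB _ _)).
have H1 : `|(j == i)%:R * (1 + q x)^-1| <= s.
  rewrite normrM sE normr_nat normrX (ger0_norm (ltW s0)).
  by case: (j == i); rewrite /=; nra.
have H2 : `|2 * (x ord0 i * (1 + q x)^-1) * (x ord0 j * (1 + q x)^-1)| <= 2 * s.
  rewrite (normrM (2 * _)) (normrM 2) (ger0_norm (_ : 0 <= 2))//.
  have := normr_ge0 (x ord0 i * (1 + q x)^-1).
  have := normr_ge0 (x ord0 j * (1 + q x)^-1).
  move: `|_| `|_| xi xj => a b; nra.
lra.
Qed.

(** The constant and the exponent [k.+1] are those that the second derivatives require, so that a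
    single bound serves both orders. *)
Lemma norm_dlogcut d k i x : 0 <= d <= 1 ->
  `|dlogcut d k.+3 i x| <=
  4 * k.+4%:R ^+ 2 * d * (Num.sqrt (1 + q x))^-1 * logcut d k.+1 x.
Proof.
move=> /andP[d0 d1]; have Dw := norm_dlogw i x d0.
have /andP[s0 s1] := inv_sqrt_le1 x.
have P12 : logcut d k.+2 x <= logcut d k.+1 x.
  by apply: ler_pospow => //; exact: logw_le1.
have P2 : 0 <= logcut d k.+2 x by exact: pospow_ge0.
have K : 0 <= (k.+3%:R : R) by [].
have K1 : (k.+3%:R : R) <= 2 * k.+4%:R ^+ 2.
  have : 0 <= (k%:R : R) by [].
  rewrite -(natr1 k.+3) -(natr1 k.+2) -(natr1 k.+1) -(natr1 k) => k0; nra.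
rewrite /dlogcut -/(logcut d k.+2 x) 2!normrM (ger0_norm K) (ger0_norm P2).
set S := _^-1 in Dw s0 s1 *.
apply: (@le_trans _ _ (2 * k.+4%:R ^+ 2 * logcut d k.+1 x * (2 * d * S))).
  apply: ler_pM => //; first by rewrite mulr_ge0.
  exact: ler_pM.
by rewrite le_eqVlt; apply/orP; left; apply/eqP; ring.
Qed.

(** The product of two first derivatives of [logw] is quadratic in d S <= 1 and is bounded linearly,
    like the other term. The constant comes from (k + 3) (4 (k + 2) + 6) <= 4 (k + 4)^2. *)
Lemma norm_ddlogcut d k i j x : 0 <= d <= 1 ->
  `|ddlogcut d k.+3 i j x| <=
  4 * k.+4%:R ^+ 2 * d * (Num.sqrt (1 + q x))^-1 * logcut d k.+1 x.
Proof.
move=> /andP[d0 d1].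
have Di := norm_dlogw i x d0; have Dj := norm_dlogw j x d0.
have Dij := norm_ddlogw i j x d0.
have /andP[s0 s1] := inv_sqrt_le1 x.
have P12 : logcut d k.+2 x <= logcut d k.+1 x.
  by apply: ler_pospow => //; exact: logw_le1.
have P2 : 0 <= logcut d k.+2 x by exact: pospow_ge0.
have P1 : 0 <= logcut d k.+1 x by exact: pospow_ge0.
rewrite /ddlogcut -/(logcut d k.+2 x) -/(logcut d k.+1 x).
set S := _^-1 in Di Dj Dij s0 s1 *.
set P := logcut d k.+1 x in P1 P12 *.
have dS : 0 <= d * S by rewrite mulr_ge0// ltW.
have H1 : `|k.+2%:R * P * dlogw d j x * dlogw d i x| <= k.+2%:R * P * (4 * d * S).
  rewrite -mulrA normrM (ger0_norm (_ : 0 <= k.+2%:R * P)) ?mulr_ge0//.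
  apply: ler_wpM2l; first by rewrite mulr_ge0.
  rewrite normrM; apply: (@le_trans _ _ ((2 * d * S) * (2 * d * S))).
    exact: ler_pM.
  have -> : 2 * d * S * (2 * d * S) = 4 * (d * S) * (d * S) by ring.
  have -> : 4 * d * S = 4 * (d * S) * 1 by ring.
  apply: ler_wpM2l; first by rewrite mulr_ge0.
  by apply: mulr_ile1 => //; exact: ltW.
have H2 : `|logcut d k.+2 x * ddlogw d i j x| <= P * (6 * d * S).
  by rewrite normrM (ger0_norm P2); exact: ler_pM.
rewrite normrM (ger0_norm (_ : 0 <= k.+3%:R))//.
apply: (@le_trans _ _ (k.+3%:R * (k.+2%:R * P * (4 * d * S) + P * (6 * d * S)))).
  by apply: ler_wpM2l => //; apply: (le_trans (ler_normD _ _)); exact: lerD.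
have -> : k.+3%:R * (k.+2%:R * P * (4 * d * S) + P * (6 * d * S)) =
  (k.+3%:R * (4 * k.+2%:R + 6)) * (d * S * P) by ring.
have -> : 4 * k.+4%:R ^+ 2 * d * S * P = (4 * k.+4%:R ^+ 2) * (d * S * P) by ring.
apply: ler_wpM2r; first by rewrite mulr_ge0.
have : 0 <= (k%:R : R) by [].
rewrite -(natr1 k.+3) -(natr1 k.+2) -(natr1 k.+1) -(natr1 k) => k0; nra.
Qed.

End log_cutoff.

(** * Bounded vector fields and test functions *)

Section bounded_operator.
Context {R : realType} {n : nat}.
Implicit Types (x : 'rV[R]_n) (i j : 'I_n) (f g : 'rV[R]_n -> R).
Local Notation e i := (delta_mx ord0 i : 'rV[R]_n).

Lemma partialZ c f i : (forall x, derivable f x (e i)) ->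
  partial i (fun x => c * f x) = (fun x => c * partial i f x).
Proof.
move=> Df; apply: partialE => x; have ? := is_derive_partial (Df x).
exact: (is_deriveZ c).
Qed.

Lemma continuously_differentiable2W f : continuously_differentiable 2 f ->
  (forall i x, derivable f x (e i)) /\
  (forall i j x, derivable (partial i f) x (e j)).
Proof.
move=> [_ D]; split => [i x|i j x]; first by have [] := D i.
by have [_ [_ /(_ j)[]]] := D i.
Qed.

Lemma continuously_differentiableZ k c f :
  continuously_differentiable k f ->
  continuously_differentiable k (fun x => c * f x).
Proof.
elim: k f => [|k IH] f [cf H]; split => //=.
- by apply: continuous_mul => //; exact: cst_continuous.
- by apply: continuous_mul => //; exact: cst_continuous.
move=> i; have [Df Hf] := H i; split => [x|].
  have ? := is_derive_partial (Df x).
  by have [] := is_deriveZ c (is_derive_partial (Df x)).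
by rewrite partialZ//; exact: IH.
Qed.

Lemma norm_sum_le N (F : 'I_N -> R) (B : R) : (forall l, `|F l| <= B) ->
  `|\sum_(l < N) F l| <= N%:R * B.
Proof.
move=> FB; apply: (le_trans (ler_norm_sum _ _ _)).
apply: (@le_trans _ _ (\sum_(l < N) B)); first exact: ler_sum.
by rewrite sumr_const card_ord mulr_natl.
Qed.

Lemma partial_vfield (a : 'I_n -> 'rV[R]_n -> R) f i x :
  (forall j, derivable (a j) x (e i)) ->
  (forall j, derivable (partial j f) x (e i)) ->
  partial i (vfield a f) x =
  \sum_(j < n) (a j x * partial i (partial j f) x
                + partial j f x * partial i (a j) x).
Proof.
move=> Da Df; rewrite /partial; apply: derive_val.
rewrite (_ : vfield a f = \sum_(j < n) (a j * partial j f)); last first.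
  by apply/funext => y; rewrite /vfield fct_sumE.
apply: is_derive_sum => j.
have ? := is_derive_partial (Da j); have ? := is_derive_partial (Df j).
by apply: is_derive_eq.
Qed.

(** Each field contributes 2 n^2 M^2 B from X_k^2, where the product rule gives a second-order and a
    first-order term, and n^2 M^2 B from (div X_k) X_k. *)
Lemma norm_sublaplacian_le m (a : 'I_m -> 'I_n -> 'rV[R]_n -> R) g x (M B : R) :
  (forall k i j, derivable (a k i) x (e j)) ->
  (forall k i, `|a k i x| <= M) ->
  (forall k i j, `|partial i (a k j) x| <= M) ->
  (forall i j, derivable (partial i g) x (e j)) ->
  (forall i, `|partial i g x| <= B) ->
  (forall i j, `|partial i (partial j g) x| <= B) ->
  `|sublaplacian a g x| <= (3 * m * n ^ 2)%:R * M ^+ 2 * B.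
Proof.
move=> Da aM daM Dg gB ggB.
rewrite /sublaplacian normrN.
have Hv k : `|vfield (a k) g x| <= n%:R * (M * B).
  apply: norm_sum_le => i.
  by rewrite normrM; apply: ler_pM.
have Hd k : `|divergence (a k) x| <= n%:R * M.
  by apply: norm_sum_le.
have Hp k i : `|partial i (vfield (a k) g) x| <= n%:R * (M * B + B * M).
  rewrite partial_vfield//; apply: norm_sum_le => j.
  apply: (le_trans (ler_normD _ _)); rewrite !normrM.
  by apply: lerD; apply: ler_pM.
have Hvv k : `|vfield (a k) (vfield (a k) g) x| <=
    n%:R * (M * (n%:R * (M * B + B * M))).
  apply: norm_sum_le => i.
  by rewrite normrM; apply: ler_pM.
have -> : (3 * m * n ^ 2)%:R * M ^+ 2 * B =
  m%:R * (n%:R * (M * (n%:R * (M * B + B * M))) + (n%:R * M) * (n%:R * (M * B))).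
  by rewrite !natrM; ring.
apply: norm_sum_le => k.
rewrite /vfield_adj; apply: (le_trans (ler_normB _ _)).
rewrite normrN normrM; apply: lerD => //.
exact: ler_pM.
Qed.

End bounded_operator.

(** * Test functions with separated variables *)

Section separated_test_functions.
Context {R : realType} {n : nat}.
Implicit Types (g : 'rV[R]_n -> R).

Lemma C2_norm_leZ (c M : R) g : continuously_differentiable 2 g ->
  C2_norm_le M g -> C2_norm_le (`|c| * M) (fun x => c * g x).
Proof.
move=> /continuously_differentiable2W[D1 D2] gM x; have [H0 H1 H2] := gM x.
have pZ i : partial i (fun y => c * g y) = (fun y => c * partial i g y).
  exact: partialZ.
split => [|i|i j]; rewrite ?pZ ?partialZ ?normrM ?ler_wpM2l//.
Qed.

(** The error of the difference quotient in time and the increment of the time derivative are both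
    scalar multiples of the fixed function [g]. Convergence in the C^2 norm thus reduces to that of
    the scalars, with tolerance [eps / M]. *)
Lemma C1c_C2c_separated (K : set 'rV[R]_n) (b M : R) (eta deta : R -> R) g :
  compact K -> C2_supported K g -> 0 < M -> C2_norm_le M g ->
  (forall t, b < t -> eta t = 0) ->
  (forall t : R, is_derive t 1 eta (deta t)) -> continuous deta ->
  C1c_C2c +oo (fun t x => eta t * g x).
Proof.
move=> cK [cg gK] M0 gM eta0 Deta cdeta.
exists K, b, (fun t x => deta t * g x); split.
- by split => //; rewrite ltry.
- move=> t _; split; split.
  + exact: continuously_differentiableZ.
  + by move=> x /gK ->; rewrite mulr0.
  + exact: continuously_differentiableZ.
  + by move=> x /gK ->; rewrite mulr0.
- by move=> t _ bt; apply/funext => x; rewrite eta0// mul0r.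
- move=> t _ eps eps0.
  have De : (fun h => h^-1 *: ((eta \o shift t) (h *: 1) - eta t)) @ 0^' -->
      deta t.
    by have [De <-] := Deta t; exact: De.
  move/cvgrPdist_le : De => /(_ (eps / M)); rewrite divr_gt0// => /(_ isT).
  move=> [r /= r0 near0]; exists r => //= s ts st _.
  rewrite (_ : (fun y => _) =
      (fun y => ((s - t)^-1 * (eta s - eta t) - deta t) * g y)); last first.
    by apply/funext => y; ring.
  have := near0 (s - t); rewrite /= sub0r normrN distrC subr_eq0.
  rewrite [(s - t) *: 1]mulr1 subrK => /(_ ts st) le0.
  have le : `|(s - t)^-1 * (eta s - eta t) - deta t| * M <= eps.
    by rewrite -ler_pdivlMr// distrC.
  move=> x; have [H0 H1 H2] :=
    C2_norm_leZ ((s - t)^-1 * (eta s - eta t) - deta t) cg gM x.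
  by split => [|i|i j]; exact: le_trans le.
- move=> t _ eps eps0.
  have /cvgrPdist_le/(_ (eps / M)) := cdeta t.
  rewrite divr_gt0// => /(_ isT); apply: filterS => s ds _.
  rewrite (_ : (fun y => _) = (fun y => (deta s - deta t) * g y)); last first.
    by apply/funext => y; rewrite mulrBl.
  move=> x; have [H0 H1 H2] := C2_norm_leZ (deta s - deta t) cg gM x.
  have le : `|deta s - deta t| * M <= eps.
    by rewrite -ler_pdivlMr// distrC.
  by split => [|i|i j]; exact: le_trans le.
Qed.

End separated_test_functions.

(** * Integral estimates *)

Section integral_without_measurability.
Context d (T : measurableType d) (R : realType).
Variable mu : {measure set T -> \bar R}.
Local Open Scope ereal_scope.

(* The integral of a nonnegative function being a supremum over the simple
   functions below it, no measurability is involved. *)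
Lemma ge0_subset_integral_le (D : set T) (f g : T -> \bar R) :
  (forall x, D x -> 0 <= f x) -> (forall x, D x -> f x <= g x) ->
  \int[mu]_(x in D) f x <= \int[mu]_(x in D) g x.
Proof.
move=> f0 fg; have g0 x : D x -> 0 <= g x.
  by move=> Dx; rewrite (le_trans (f0 x Dx))// fg.
rewrite !ge0_integralE//; apply: le_ereal_sup => _ [h hf <-].
exists h => // x; apply: (le_trans (hf x)).
by rewrite /patch; case: ifPn => // /set_mem; exact: fg.
Qed.

(** The negative part of [h] lies below [g], and discarding the positive part only lowers the
    integral, also under the convention for +oo - +oo. *)
Lemma oppe_integral_le (D : set T) (g h : T -> \bar R) :
  (forall x, D x -> 0 <= g x) -> (forall x, D x -> - g x <= h x) ->
  - (\int[mu]_(x in D) g x) <= \int[mu]_(x in D) h x.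
Proof.
move=> g0 gh; rewrite [leRHS]integralE.
apply: (@le_trans _ _ (- (\int[mu]_(x in D) h^\- x))).
  rewrite leeN2; apply: ge0_subset_integral_le => // x Dx.
  by rewrite funenegE ge_max g0// leeNl gh.
by apply: leeDr; exact: integral_ge0.
Qed.

End integral_without_measurability.

(** * Young's inequality with a weight *)

Section young.
Context {R : realType}.

(** Here [n] is the dimension minus one, so the conjugate exponents are (n + 1) / n and n + 1.
    Young's inequality is applied to s v^(2 n) and 2 b: the 2 attached to [b] leaves the factor 1/2
    on the term in [s], so that two such terms can be absorbed, and the weights 1 / p and 1 / (n +
    1) are bounded by 1. *)
Lemma young_weighted (n : nat) (s v b : R) : (0 < n)%N ->
  0 <= s -> 0 <= v -> 0 <= b ->
  s * (v ^+ (2 * n) * b) <=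
  2^-1 * (s `^ (n.+1%:R / n%:R) * v ^+ (2 * n.+1)) + (2 * b) ^+ n.+1.
Proof.
move=> n0 s0 v0 b0; set p := n.+1%:R / n%:R.
have n0' : 0 < (n%:R : R) by rewrite ltr0n.
have p0 : 0 < p by rewrite divr_gt0.
have pq : p^-1 + n.+1%:R^-1 = 1.
  by rewrite invf_div -natr1; field; rewrite -?natr1 !gt_eqF//; lra.
have := @conjugate_powR R (s * v ^+ (2 * n)) (2 * b) p n.+1%:R.
rewrite !mulr_ge0 ?exprn_ge0// => /(_ isT isT p0 (ltr0Sn _ _) pq).
rewrite powR_mulrn ?mulr_ge0// powRM ?exprn_ge0//.
rewrite -(powR_mulrn (2 * n))// -powRrM.
have -> : ((2 * n)%:R : R) * p = (2 * n.+1)%:R.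
  by rewrite /p !natrM; field; rewrite gt_eqF.
rewrite !powR_mulrn ?mulr_ge0//.
set a := s `^ p * _; set c := (2 * b) ^+ _.
have a0 : 0 <= a by rewrite mulr_ge0 ?powR_ge0 ?exprn_ge0.
have c0 : 0 <= c by rewrite exprn_ge0// mulr_ge0.
have p1 : p^-1 <= 1.
  by rewrite -pq lerDl invr_ge0.
have n1 : (n.+1%:R^-1 : R) <= 1 by rewrite invf_le1 ?ltr0Sn// ler1n.
have ap : a / p <= a by rewrite ler_piMr.
have cn : c / n.+1%:R <= c by rewrite ler_piMr.
move: (_ / p) ap (_ / _) cn => x xa y yc.
set z := v ^+ _; nra.
Qed.

End young.

(** * Cubes and their volume *)

Section cubes.
Context {R : realType} {n : nat}.
Implicit Types (x : 'rV[R]_n) (r : R).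
Local Open Scope ereal_scope.

Definition cube r : set 'rV[R]_n := [set x | forall i, x ord0 i \in `[(- r)%R, r]].

Lemma measurable_cube r : measurable (cube r).
Proof.
rewrite (_ : cube r = [set x | forall i, [set` `[(- r)%R, r]] (x ord0 i)])//.
apply: (@measurable_rV_box _ n (fun=> [set` `[(- r)%R, r]])) => i.
exact: measurable_itv.
Qed.

Lemma compact_cube r : compact (cube r).
Proof.
apply: (@rV_compact R n (fun=> [set` `[(- r)%R, r]])) => i.
exact: segment_compact.
Qed.

Lemma lebesgue_rV_cube r : (0 <= r)%R ->
  lebesgue_rV (cube r) = ((2 * r) ^+ n)%:E.
Proof.
move=> r0; rewrite (lebesgue_rV_box (D := fun=> [set` `[(- r)%R, r]])); last first.
  by move=> i; exact: measurable_itv.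
under eq_bigr do rewrite lebesgue_measure_itv/=.
rewrite (eq_bigr (fun=> (2 * r)%:E)).
  by rewrite prodEFin prodr_const card_ord.
move=> i _; rewrite lte_fin; case: ltP => rr.
  by rewrite -EFinD opprK; congr EFin; lra.
by congr EFin; lra.
Qed.

End cubes.

(** * A majorant of (1 + |x|^2)^(-n/2) with logarithmic mass *)

Section log_weight.
Context {R : realType} {n : nat}.
Implicit Types (x : 'rV[R]_n) (N k : nat).
Local Notation q := (@sqnorm R n).

(* An upper bound, on the support of the cut-off, for (1 + |x|^2)^(-n/2): the
   j-th term accounts for the points where j <= ln (1 + |x|^2) < j + 1. *)
Definition log_weight N x : R :=
  \sum_(j < N) expR (- (j%:R / 2)) ^+ n * \1_(cube (expR (j.+1%:R / 2))) x.

Lemma sqrt_sqnorm1 x : Num.sqrt (1 + q x) = expR (ln (1 + q x) / 2).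
Proof.
rewrite -{1}(lnK (sqnorm1_gt0 x)) -[X in Num.sqrt X]sqr_sqrtr ?expR_ge0//.
rewrite sqrtr_sqr ger0_norm ?sqrtr_ge0//.
rewrite -[X in expR X](@mulfVK _ 2)// {1}mulr_natr mulr2n expRD -expr2.
by rewrite sqrtr_sqr ger0_norm// expR_ge0.
Qed.

Lemma ln_sqnorm1_lt N x :
  0 < logw N.+1%:R^-1 x -> ln (1 + q x) < N.+1%:R.
Proof. by rewrite subr_gt0 ltr_pdivrMl ?ltr0Sn// mulr1. Qed.

Lemma norm_coord_le (r : R) x i : ln (1 + q x) <= r ->
  `|x ord0 i| <= expR (r / 2).
Proof.
move=> lr; apply: (@le_trans _ _ (expR (ln (1 + q x) / 2))); last first.
  by rewrite ler_expR ler_pM2r.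
rewrite -sqrt_sqnorm1 -sqrtr_sqr ler_wsqrtr//.
by apply: (le_trans (ler_sqnorm x i)); rewrite lerDr.
Qed.

(** This cube is both the compact support of the cut-off and, through its volume, the bound on the
    region that the time-derivative term sees. *)
Lemma logw_gt0_cube N x : 0 < logw N.+1%:R^-1 x -> cube (expR (N.+1%:R / 2)) x.
Proof.
move=> /ln_sqnorm1_lt/ltW xN i; rewrite in_itv/= -ler_norml.
exact: norm_coord_le.
Qed.

Lemma log_weight_ge0 N x : 0 <= log_weight N x.
Proof. by apply: sumr_ge0 => j _; rewrite mulr_ge0// exprn_ge0// expR_ge0. Qed.

(** The term whose index is the integer part of ln (1 + |x|^2) already dominates; the other terms
    are nonnegative. *)
Lemma le_log_weight N x : 0 < logw N.+1%:R^-1 x ->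
  (Num.sqrt (1 + q x))^-1 ^+ n <= log_weight N.+1 x.
Proof.
move=> /ln_sqnorm1_lt xN.
have l0 : 0 <= ln (1 + q x) by rewrite ln_ge0// lerDl sqnorm_ge0.
have /andP[jl lj] := truncn_itv l0.
have jN : (Num.truncn (ln (1 + q x)) < N.+1)%N.
  by rewrite -(ltr_nat R); exact: le_lt_trans xN.
rewrite /log_weight (bigD1 (Ordinal jN))//= -[leLHS]addr0; apply: lerD.
  rewrite indicE mem_set ?mulr1; last first.
    by move=> i; rewrite in_itv/= -ler_norml; apply: norm_coord_le; exact: ltW.
  rewrite sqrt_sqnorm1 -expRN; apply: lerXn2r; rewrite ?nnegrE ?expR_ge0//.
  by rewrite ler_expR lerN2 ler_pM2r.
by apply: sumr_ge0 => j _; rewrite mulr_ge0// exprn_ge0// expR_ge0.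
Qed.

Lemma measurable_log_weight N : measurable_fun setT (log_weight N).
Proof.
apply: measurable_sum => j; apply: measurable_funM => //.
by apply: measurable_indic; exact: measurable_cube.
Qed.

(** The volume (2 exp ((j + 1) / 2))^n of the j-th cube cancels the factor exp (- j n / 2) up to a
    constant. All terms have the same mass, and the total grows only linearly in [N]. *)
Lemma integral_log_weight N :
  (\int[@lebesgue_rV R n]_x (log_weight N x)%:E =
   (N%:R * (2 * expR 2^-1) ^+ n)%:E)%E.
Proof.
under eq_integral do rewrite -sumEFin.
rewrite ge0_integral_sum//; last first.
  move=> j; apply/measurable_EFinP/measurable_funM => //.
  by apply: measurable_indic; exact: measurable_cube.
rewrite (eq_bigr (fun=> ((2 * expR 2^-1) ^+ n)%:E)).
  by rewrite sumEFin sumr_const card_ord [in RHS](mulr_natl _ N).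
move=> j _; under eq_integral do rewrite EFinM.
rewrite ge0_integralZl_EFin ?exprn_ge0 ?expR_ge0//; last first.
  by apply/measurable_EFinP/measurable_indic; exact: measurable_cube.
rewrite integral_indic//; last exact: measurable_cube.
rewrite setIT [X in (_ * X)%E]lebesgue_rV_cube ?expR_ge0// -EFinM -exprMn.
congr ((_ ^+ _)%:E); rewrite mulrCA -expRD; congr (_ * expR _).
by rewrite -natr1; lra.
Qed.

End log_weight.

(** * Lower bounds for iterated integrals *)

Section lower_bound.
Context {R : realType} {n : nat}.
Implicit Types (V : 'rV[R]_n -> R) (a h : R -> 'rV[R]_n -> R).
Local Open Scope ereal_scope.
Local Notation dt := (@lebesgue_measure R).
Local Notation dx := (@lebesgue_rV R n).

Lemma Ioo0yE : Ioo0 +oo = `]0%R, +oo[%classic :> set R.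
Proof.
apply/seteqP; split => t /=; rewrite in_itv/= andbT; first by case.
by move=> t0; split => //=; rewrite ltry.
Qed.

Lemma measurable_Ioo0y : measurable (Ioo0 +oo : set R).
Proof. by rewrite Ioo0yE; exact: measurable_itv. Qed.

Lemma integral_time_indic (T : R) : (0 < T)%R ->
  \int[dt]_(t in Ioo0 +oo) ((t < T)%R%:R)%:E = T%:E.
Proof.
move=> T0.
transitivity (\int[dt]_(t in Ioo0 +oo) (\1_`]-oo, T[%classic t)%:E).
  by apply: eq_integral => t _; rewrite indicE mem_setE in_itv.
rewrite integral_indic//; last by rewrite Ioo0yE; exact: measurable_itv.
rewrite (_ : _ `&` _ = `]0%R, T[%classic).
  transitivity (lebesgue_measure [set` `]0%R, T[]); first by [].
  by rewrite lebesgue_measure_itv/= lte_fin T0 oppr0 adde0.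
apply/seteqP; rewrite Ioo0yE; split => t /=; rewrite !in_itv/= andbT.
  by move=> [-> ->].
by move=> /andP[-> ->].
Qed.

Section majorant.
Variables (a : R -> 'rV[R]_n -> R) (V : 'rV[R]_n -> R) (v T : R).
Hypothesis ma :
  measurable_fun (Ioo0 +oo `*` [set: 'rV[R]_n]) (fun z => a z.1 z.2).
Hypothesis a0 : forall t x, (0 < t)%R -> (0 <= a t x)%R.
Hypothesis mV : measurable_fun setT V.
Hypothesis V0 : forall x, (0 <= V x)%R.
Hypothesis iV : \int[dx]_x (V x)%:E = v%:E.
Hypothesis T0 : (0 < T)%R.

(** Extended by zero, the integrand is measurable on the whole product space, as needed for the
    measurability of its inner integral by Tonelli. *)
Let aE : R * 'rV[R]_n -> \bar R :=
  (fun z => (a z.1 z.2)%:E) \_ (Ioo0 +oo `*` [set: 'rV[R]_n]).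

Let maE : measurable_fun setT aE.
Proof.
apply/(measurable_restrictT _ _).1; last exact/measurable_EFinP.
by apply: measurableX => //; exact: measurable_Ioo0y.
Qed.

Let aE0 z : 0 <= aE z.
Proof.
rewrite /aE /patch; case: ifPn => // /set_mem[[t0 _] _].
by rewrite lee_fin a0.
Qed.

Let aEE t x : Ioo0 +oo t -> aE (t, x) = (a t x)%:E.
Proof. by move=> t0; rewrite /aE patchE mem_set. Qed.

Let integral_aE t : Ioo0 +oo t -> \int[dx]_x (a t x)%:E = \int[dx]_x aE (t, x).
Proof. by move=> t0; apply: eq_integral => x _; rewrite aEE. Qed.

Lemma integral_majorant :
  \int[dt]_(t in Ioo0 +oo) \int[dx]_x (2^-1 * a t x + V x * (t < T)%R%:R)%:E =
  2^-1%:E * (\int[dt]_(t in Ioo0 +oo) \int[dx]_x (a t x)%:E) + (v * T)%:E.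
Proof.
have v0 : (0 <= v)%R.
  by rewrite -lee_fin -iV; apply: integral_ge0 => x _; rewrite lee_fin.
have H t : t \in Ioo0 +oo ->
    \int[dx]_x (2^-1 * a t x + V x * (t < T)%R%:R)%:E =
    2^-1%:E * (\int[dx]_x aE (t, x)) + (v * (t < T)%R%:R)%:E.
  move=> /set_mem t0.
  have mat : measurable_fun setT (fun x => aE (t, x)).
    exact: measurable_fun_pair2.
  transitivity (\int[dx]_x (2^-1%:E * aE (t, x) + (t < T)%R%:R%:E * (V x)%:E)).
    by apply: eq_integral => x _; rewrite aEE// EFinD EFinM mulrC EFinM.
  rewrite ge0_integralD//; last 4 first.
  - by move=> x _; rewrite mule_ge0// lee_fin invr_ge0.
  - exact: measurable_funeM.
  - by move=> x _; rewrite -EFinM lee_fin mulr_ge0.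
  - by apply: measurable_funeM; exact/measurable_EFinP.
  rewrite ge0_integralZl_EFin// ge0_integralZl_EFin//; last 2 first.
  - by move=> x _; rewrite lee_fin.
  - exact/measurable_EFinP.
  by congr (_ + _); rewrite iV -EFinM mulrC.
transitivity (\int[dt]_(t in Ioo0 +oo)
    (2^-1%:E * (\int[dx]_x aE (t, x)) + v%:E * ((t < T)%R%:R)%:E)).
  by apply: eq_integral => t; rewrite -EFinM; exact: H.
have mA : measurable_fun setT (fun t => \int[dx]_x aE (t, x)).
  exact: measurable_fun_fubini_tonelli_F.
have mA' : measurable_fun (Ioo0 +oo : set R) (fun t => \int[dx]_x aE (t, x)).
  exact: measurable_funTS.
have mT : measurable_fun (Ioo0 +oo : set R) (fun t => ((t < T)%R%:R)%:E : \bar R).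
  apply: measurable_funTS; apply/measurable_EFinP.
  rewrite (_ : (fun t => _) = (\1_`]-oo, T[%classic : R -> R)).
    by apply: measurable_indic; exact: measurable_itv.
  by apply/funext => t; rewrite indicE mem_setE in_itv.
rewrite ge0_integralD//; last 5 first.
- exact: measurable_Ioo0y.
- by move=> t _; rewrite mule_ge0 ?lee_fin ?invr_ge0//; exact: integral_ge0.
- exact: measurable_funeM.
- by move=> t _; rewrite -EFinM lee_fin mulr_ge0.
- exact: measurable_funeM.
rewrite ge0_integralZl_EFin//; last 2 first.
- exact: measurable_Ioo0y.
- by move=> t _; exact: integral_ge0.
rewrite ge0_integralZl_EFin//; last exact: measurable_Ioo0y.
congr (_ * _ + _); first by apply: eq_integral => t /set_mem t0; rewrite integral_aE.
by rewrite EFinM; congr (_ * _); exact: integral_time_indic.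
Qed.

(** The pointwise bound passes through the inner and then the outer integral by [oppe_integral_le];
    this one-sided form copes with an [h] of unknown sign and integrability. *)
Lemma iterated_integral_ge (h : R -> 'rV[R]_n -> R) :
  (forall t x, (0 < t)%R ->
    (`|h t x| <= 2^-1 * a t x + V x * (t < T)%R%:R)%R) ->
  - (2^-1%:E * (\int[dt]_(t in Ioo0 +oo) \int[dx]_x (a t x)%:E) + (v * T)%:E) <=
  \int[dt]_(t in Ioo0 +oo) \int[dx]_x (h t x)%:E.
Proof.
move=> hb; rewrite -integral_majorant.
have b0 t x : (0 < t)%R -> (0 <= 2^-1 * a t x + V x * (t < T)%R%:R)%R.
  by move=> t0; apply: le_trans (hb _ _ t0).
apply: oppe_integral_le => [t [t0 _]|t [t0 _]].
  by apply: integral_ge0 => x _; rewrite lee_fin b0.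
apply: oppe_integral_le => x _; first by rewrite lee_fin b0.
rewrite -EFinN lee_fin lerNl; apply: (le_trans (ler_norm _)).
by rewrite normrN hb.
Qed.

End majorant.

End lower_bound.

(** * Integrals against cut-offs increasing to 1 *)

Section cutoff_integrals.
Context d (T : measurableType d) (R : realType).
Variable mu : {measure set T -> \bar R}.
Implicit Types (f phi : T -> R).
Local Open Scope ereal_scope.

(** Replacing [f] by its positive part changes the integrand on a null set only. *)
Lemma integral_mul_ge0 f phi : measurable_fun setT f -> measurable_fun setT phi ->
  {ae mu, forall x, (0 <= f x)%R} -> (forall x, (0 <= phi x)%R) ->
  0 <= \int[mu]_x (f x * phi x)%:E.
Proof.
move=> mf mphi f0 phi0.
rewrite (@ae_eq_integral _ _ _ mu setT (fun x => (Num.max (f x) 0 * phi x)%:E))//.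
- by apply: integral_ge0 => x _; rewrite lee_fin mulr_ge0// le_max lexx orbT.
- exact/measurable_EFinP/measurable_funM.
- by apply/measurable_EFinP/measurable_funM => //; exact: measurable_maxr.
by apply: filterS f0 => x fx0 _; rewrite max_l.
Qed.

Let integral_mul_funrposneg f phi : (forall x, (0 <= phi x)%R) ->
  \int[mu]_x (f x * phi x)%:E =
  \int[mu]_x ((f^\+)%R x * phi x)%:E - \int[mu]_x ((f^\-)%R x * phi x)%:E.
Proof.
move=> phi0; rewrite integralE; congr (_ - _); apply: eq_integral => x _.
  by rewrite funeposE -EFin_max /funrpos maxr_pMl// mul0r.
by rewrite funenegE -EFinN -EFin_max /funrneg maxr_pMl// mul0r mulNr.
Qed.

Let exists_EFin_between (u v : \bar R) : u \is a fin_num -> u < v ->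
  exists2 s : R, u < s%:E & s%:E < v.
Proof.
move: u v => [u| |] [v| |]//= _ uv.
- by exists ((u + v) / 2)%R; rewrite lte_fin in uv; rewrite lte_fin; lra.
- by exists (u + 1)%R; rewrite ?ltry// lte_fin ltrDl.
Qed.

(** Positivity of the integral makes that of the negative part finite. A real [s] strictly between
    the integrals of the negative and positive parts is eventually exceeded by the cut-off positive
    part (monotone convergence), while the cut-off negative part never exceeds its full integral; r
    is the gap. The total may be +oo, and the threshold for [N] is chosen before [c]. *)
Lemma integral_mul_cutoff_ge f (phi : nat -> T -> R) :
  measurable_fun setT f -> (forall N, measurable_fun setT (phi N)) ->
  (forall N x, (0 <= phi N x <= 1)%R) ->
  (forall x, nondecreasing_seq (phi ^~ x)) ->
  (forall x, phi N x @[N --> \oo] --> (1 : R)%R) ->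
  0 < \int[mu]_x (f x)%:E ->
  exists2 r : R, (0 < r)%R & \forall N \near \oo,
    forall c, (0 <= c)%R -> (c * r)%:E <= \int[mu]_x (f x * (c * phi N x))%:E.
Proof.
move=> mf mphi phi01 ndphi phi1 fpos.
have mfp : measurable_fun setT (f^\+)%R by exact: measurable_funrpos.
have mfn : measurable_fun setT (f^\-)%R by exact: measurable_funrneg.
set Ip := \int[mu]_x ((f^\+)%R x)%:E; set Im := \int[mu]_x ((f^\-)%R x)%:E.
have Im0 : 0 <= Im.
  by apply: integral_ge0 => x _; rewrite lee_fin funrneg_ge0.
have IE : 0 < Ip - Im.
  move: fpos; have := @integral_mul_funrposneg f (cst 1%R) (fun=> ler01).
  by under eq_integral do rewrite mulr1; under [in X in _ = X - _]eq_integral do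
    rewrite mulr1; under [in X in _ = _ - X]eq_integral do rewrite mulr1; move=> ->.
have Imfin : Im \is a fin_num.
  by rewrite ge0_fin_numE// ltey; apply/eqP => Imy; move: IE; rewrite Imy addeNy.
have ImIp : Im < Ip by rewrite -sube_gt0.
have [s Ims sIp] : exists2 s : R, Im < s%:E & s%:E < Ip.
  exact: exists_EFin_between.
pose g N x : \bar R := ((f^\+)%R x * phi N x)%:E.
have mg N : measurable_fun setT (g N).
  exact/measurable_EFinP/measurable_funM.
have g0 N x : setT x -> 0 <= g N x.
  by have /andP[p0 _] := phi01 N x; rewrite lee_fin mulr_ge0// funrpos_ge0.
have ndg x : setT x -> nondecreasing_seq (g ^~ x).
  by move=> _ M N MN; rewrite lee_fin ler_wpM2l ?funrpos_ge0// ndphi.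
have limg : \int[mu]_x limn (g ^~ x) = Ip.
  apply: eq_integral => x _; apply/cvg_lim => //.
  apply: cvg_EFin; first by near=> N.
  rewrite -[X in _ --> X]mulr1; apply: cvgM; first exact: cvg_cst.
  exact: phi1.
have cvgI : \int[mu]_x g N x @[N --> \oo] --> Ip.
  by rewrite -limg; exact: cvg_monotone_convergence.
have ndI : nondecreasing_seq (fun N => \int[mu]_x g N x).
  by move=> M N MN; apply: ge0_subset_integral_le => x _; [exact: g0|exact: (ndg x I)].
have sI : \forall N \near \oo, s%:E <= \int[mu]_x g N x.
  apply: lte_lim => //; first by apply/cvg_ex; exists Ip.
  by rewrite (cvg_lim _ cvgI).
exists (s - fine Im)%R.
  by rewrite subr_gt0 -lte_fin fineK.
near=> N => c c0.
have phi0 x : (0 <= phi N x)%R by have /andP[] := phi01 N x.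
rewrite integral_mul_funrposneg; last by move=> x; rewrite mulr_ge0.
have E (h : T -> R) : (forall x, (0 <= h x)%R) -> measurable_fun setT h ->
    \int[mu]_x (h x * (c * phi N x))%:E = c%:E * \int[mu]_x (h x * phi N x)%:E.
  move=> h0 mh; rewrite -ge0_integralZl_EFin//; last 2 first.
  - by move=> x _; rewrite lee_fin mulr_ge0.
  - exact/measurable_EFinP/measurable_funM.
  by apply: eq_integral => x _; rewrite -EFinM mulrCA.
rewrite !E//.
rewrite mulrBr EFinB; apply: leeB.
  by rewrite EFinM; apply: lee_wpmul2l => //; near: N.
rewrite EFinM fineK//; apply: lee_wpmul2l => //.
apply: ge0_subset_integral_le => x _; first by rewrite lee_fin mulr_ge0// funrneg_ge0.
by rewrite lee_fin ler_piMr ?funrneg_ge0//; have /andP[] := phi01 N x.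
Unshelve. all: by end_near. Qed.

End cutoff_integrals.

(** * Measurability and monotone convergence of the logarithmic cut-offs *)

Section log_cutoff_sequence.
Context {R : realType} {n : nat}.
Implicit Types (x : 'rV[R]_n) (N k : nat).
Local Notation q := (@sqnorm R n).

Lemma measurable_logw (r : R) : measurable_fun setT (@logw R n r).
Proof.
apply: measurable_funB => //; apply: measurable_funM => //.
apply: measurableT_comp => //; apply: measurable_funD => //.
apply: measurable_sum => i; apply: measurable_funX.
exact: measurable_coord_rV.
Qed.

Lemma measurable_logcut (r : R) k : measurable_fun setT (@logcut R n r k).
Proof.
apply: measurable_funX; apply: measurable_maxr => //; exact: measurable_logw.
Qed.

Lemma logcut_ge0_le1 (r : R) k x : 0 <= r -> 0 <= logcut r k x <= 1.
Proof. by move=> r0; rewrite pospow_ge0 pospow_le1//; exact: logw_le1. Qed.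

Lemma nondecreasing_logcut k x :
  nondecreasing_seq (fun N => logcut N.+1%:R^-1 k x : R).
Proof.
move=> M N MN; apply: le_pospow; rewrite lerD2l lerN2.
apply: ler_wpM2r; first by rewrite ln_ge0// lerDl sqnorm_ge0.
by rewrite lef_pV2 ?posrE ?ltr0Sn// ler_nat ltnS.
Qed.

Lemma cvg_logcut k x : logcut N.+1%:R^-1 k x @[N --> \oo] --> (1 : R).
Proof.
have w1 : logw N.+1%:R^-1 x @[N --> \oo] --> (1 : R).
  rewrite -[X in _ --> X]subr0; apply: cvgB; first exact: cvg_cst.
  rewrite -[X in _ --> X](mul0r (ln (1 + q x))); apply: cvgM; last exact: cvg_cst.
  exact: cvg_harmonic.
have p1 : pospow k 1 = 1 :> R by rewrite pospowE// expr1n.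
rewrite -[X in _ --> X]p1.
exact: (continuous_cvg _ (@continuous_pospow R k 1) w1).
Qed.

End log_cutoff_sequence.

(** * The test function and the contradiction *)

Section time_cutoff.
Context {R : realType}.
Implicit Types (T t : R) (k : nat).

Definition timecut T k t : R := pospow k (1 - T^-1 * t).

Definition dtimecut T k t : R := - (k%:R / T) * timecut T k.-1 t.

Lemma is_derive_timecut T k t :
  is_derive t 1 (timecut T k.+2) (dtimecut T k.+2 t).
Proof.
have D : is_derive t 1 (cst 1 - T^-1 *: id : R -> R) (0 - T^-1 *: 1)
  by apply: is_deriveB.
have H := is_derive_comp1 D (is_derive_pospow k (1 - T^-1 * t)).
apply: (is_derive_eq H).
by rewrite /dtimecut /timecut /GRing.scale/=; ring.
Qed.

Lemma continuous_timecut T k : continuous (timecut T k).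
Proof.
move=> t; apply: (@continuous_comp _ _ _ (fun t => 1 - T^-1 * t) (pospow k)).
  apply: continuous_sub; first exact: cst_continuous.
  apply: continuous_mul; first exact: cst_continuous.
  by move=> s; exact: cvg_id.
exact: continuous_pospow.
Qed.

Lemma continuous_dtimecut T k : continuous (dtimecut T k).
Proof.
by apply: continuous_mul; [exact: cst_continuous|exact: continuous_timecut].
Qed.

Lemma timecut_eq0 T k t : 0 < T -> T <= t -> timecut T k.+1 t = 0.
Proof. by move=> T0 Tt; apply: pospow_eq0; rewrite subr_le0 ler_pdivlMl// mulr1. Qed.

(** Up to time T / 2 the base of the power is at least 1/2. *)
Lemma integral_timecut_ge T k : 0 < T ->
  ((T / 2 ^+ k.+1)%:E <=
   \int[@lebesgue_measure R]_(t in Ioo0 +oo) (timecut T k t)%:E)%E.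
Proof.
move=> T0; have T20 : 0 < T / 2 by rewrite divr_gt0.
have mI : measurable_fun (Ioo0 +oo : set R) (fun t => ((t < T / 2)%R%:R)%:E : \bar R).
  apply: measurable_funTS; apply/measurable_EFinP.
  rewrite (_ : (fun t => _) = (\1_`]-oo, (T / 2)[%classic : R -> R)).
    by apply: measurable_indic; exact: measurable_itv.
  by apply/funext => t; rewrite indicE mem_setE in_itv.
apply: (@le_trans _ _ (\int[@lebesgue_measure R]_(t in Ioo0 +oo)
    ((2 ^+ k)^-1%:E * ((t < T / 2)%R%:R)%:E)%E)%E).
  rewrite ge0_integralZl_EFin ?invr_ge0 ?exprn_ge0//; last exact: measurable_Ioo0y.
  rewrite (integral_time_indic T20) -EFinM lee_fin exprS invfM.
  by rewrite (mulrC (2 ^+ k)^-1) mulrA.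
apply: ge0_subset_integral_le => t [t0 _].
  by rewrite -EFinM lee_fin mulr_ge0// invr_ge0 exprn_ge0.
rewrite -EFinM lee_fin; have [tT|_] := ltP t (T / 2); last first.
  by rewrite mulr0 pospow_ge0.
rewrite mulr1 -exprVn -(@pospowE _ k 2^-1)//; apply: le_pospow.
have : T^-1 * t <= T^-1 * (T / 2).
  by apply: ler_wpM2l; [rewrite invr_ge0 ltW|exact: ltW].
rewrite mulrA mulVf ?gt_eqF// => le; lra.
Qed.

End time_cutoff.

(** * Absorption of the terms in u *)

Section absorption.
Context {R : realType}.

(** Where a cut-off vanishes, so does [c], which accounts for the indicator; elsewhere this is
    [young_weighted] with v = s w. *)
Lemma young_cutoff (n : nat) (u c b s w : R) : (0 < n)%N -> 0 <= b ->
  `|c| <= b * (pospow (2 * n) s * pospow (2 * n) w) ->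
  `|u * c| <= 2^-1 * (`|u| `^ (n.+1%:R / n%:R) *
                (pospow (2 * n.+1) s * pospow (2 * n.+1) w))
    + (2 * b) ^+ n.+1 * ((0 < s) && (0 < w))%:R.
Proof.
move=> n0 b0 cb.
have [/andP[s0 w0]|sw] := boolP ((0 < s) && (0 < w)); last first.
  have -> : c = 0.
    apply/normr0_eq0/eqP; rewrite eq_le normr_ge0 andbT (le_trans cb)//.
    (* As [n] is positive, the exponent 2 n is a successor and the power vanishes at nonpositive
       arguments. *)
    rewrite -(prednK (_ : 0 < 2 * n)%N) ?muln_gt0//.
    move: sw; rewrite negb_and -!leNgt => /orP[] /pospow_eq0 ->.
      by rewrite mul0r mulr0.
    by rewrite !mulr0.
  by rewrite mulr0 normr0 mulr0 addr0 !mulr_ge0 ?powR_ge0 ?pospow_ge0.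
rewrite !(pospowE _ (ltW s0)) !(pospowE _ (ltW w0)) -!exprMn in cb *.
rewrite mulr1.
apply: (@le_trans _ _ (`|u| * ((s * w) ^+ (2 * n) * b))).
  by rewrite normrM ler_wpM2l// mulrC.
by apply: young_weighted => //; rewrite mulr_ge0// ltW.
Qed.

Local Open Scope ereal_scope.

(** [A] to [E] stand for the terms in |u|^p, u_0, f, psi_t and Delta_X psi. A zero sum forces all of
    them to be finite; then the two halves of [A] cancel [A], and [B] is dropped by its sign. *)
Lemma le_of_balance (A B F D E : \bar R) (c c1 c2 : R) :
  0 <= A -> 0 <= B -> (0 <= c)%R -> c%:E <= F ->
  - (2^-1%:E * A + c1%:E) <= D -> - (2^-1%:E * A + c2%:E) <= E ->
  A + B + F + D + E = 0 -> (c <= c1 + c2)%R.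
Proof.
case: A => [A| |]//; case: B => [B| |]//; case: F => [F| |]//;
  case: D => [D| |]//; case: E => [E| |]//= A0 B0 c0 cF D0 E0 //.
rewrite -!EFinD => -[S]; rewrite !lee_fin in A0 B0 cF D0 E0; lra.
Qed.

End absorption.

(** * The test function and bounds on its derivatives *)

Section test_function.
Context {R : realType} {n : nat}.
Implicit Types (x : 'rV[R]_n) (N k : nat) (T t r : R).

Definition log_test T N k t x : R :=
  timecut T k t * logcut N.+1%:R^-1 k x.

Let inv01 N : 0 <= (N.+1%:R^-1 : R) <= 1.
Proof. by rewrite invr_ge0 ler0n invf_le1 ?ltr0Sn// ler1n. Qed.

Lemma logcut_C2 r k : continuously_differentiable 2 (@logcut R n r k.+3).
Proof.
split; first exact: continuous_logcut.
move=> i; split => [x|].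
  by have [] := is_derive_logcut r k.+1 i x.
rewrite partial_logcut; split; first exact: continuous_dlogcut.
move=> j; split => [x|].
  by have [] := is_derive_dlogcut r k i j x.
by rewrite partial_dlogcut; split => //; exact: continuous_ddlogcut.
Qed.

Lemma logcut_C2_norm_le N k :
  C2_norm_le (4 * k.+4%:R ^+ 2) (@logcut R n N.+1%:R^-1 k.+3).
Proof.
move=> x; have /andP[d0 d1] := inv01 N.
have C : 1 <= (4 * k.+4%:R ^+ 2 : R).
  by rewrite -natrX -natrM ler1n; lia.
have S01 : 0 <= (Num.sqrt (1 + sqnorm x))^-1 <= 1.
  rewrite invr_ge0 sqrtr_ge0/= invf_le1 ?sqrtr_gt0 ?sqnorm1_gt0//.
  by rewrite -[leLHS]sqrtr1 ler_wsqrtr// lerDl sqnorm_ge0.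
have /andP[s0 s1] := S01.
have /andP[p0 p1] : 0 <= logcut N.+1%:R^-1 k.+1 x <= 1 by exact: logcut_ge0_le1.
have le : 4 * k.+4%:R ^+ 2 * N.+1%:R^-1 * (Num.sqrt (1 + sqnorm x))^-1
    * logcut N.+1%:R^-1 k.+1 x <= 4 * k.+4%:R ^+ 2.
  rewrite -!(mulrA (4 * _)) ler_piMr ?(le_trans ler01 C)//.
  by rewrite !mulr_ile1// mulr_ge0.
split => [|i|i j].
- rewrite ger0_norm ?pospow_ge0// (le_trans _ C)//.
  by have /andP[] := logcut_ge0_le1 k.+3 x d0.
- by rewrite partial_logcut; apply: le_trans le; exact: norm_dlogcut.
- by rewrite partial_logcut partial_dlogcut; apply: le_trans le; exact: norm_ddlogcut.
Qed.

Lemma log_test_C1c_C2c T N k : 0 < T -> C1c_C2c +oo (log_test T N k.+3).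
Proof.
move=> T0.
apply: (@C1c_C2c_separated _ _ (cube (expR (N.+1%:R / 2))) T
  (4 * k.+4%:R ^+ 2) _ (dtimecut T k.+3)).
- exact: compact_cube.
- split; first exact: logcut_C2.
  move=> x xK; apply: pospow_eq0; rewrite leNgt; apply/negP => /logw_gt0_cube.
  by [].
- by rewrite mulr_gt0// exprn_gt0.
- exact: logcut_C2_norm_le.
- by move=> t /ltW; exact: timecut_eq0.
- by move=> t; exact: is_derive_timecut.
- exact: continuous_dtimecut.
Qed.

Lemma log_test_ge0 T N k t x : 0 <= log_test T N k t x.
Proof. by rewrite mulr_ge0// pospow_ge0. Qed.

Lemma timecut_le T k l t : 0 < T -> 0 <= t -> (k <= l)%N ->
  timecut T l t <= timecut T k t.
Proof.
move=> T0 t0 kl; apply: ler_pospow => //.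
by rewrite gerBl mulr_ge0// invr_ge0 ltW.
Qed.

Lemma logcut_le N k l x : (k <= l)%N ->
  logcut N.+1%:R^-1 l x <= logcut N.+1%:R^-1 k x.
Proof. by move=> kl; apply: ler_pospow => //; apply: logw_le1. Qed.

(** Powers are given up until both cut-offs carry the exponent [k.+1], two below that of the test
    function: the exponent from which Young's inequality recovers the test function itself. The same
    is done in [log_test_sublaplacian]. *)
Lemma log_test_derive1 T N k t x : 0 < T -> 0 <= t ->
  `|derive1 (log_test T N k.+3 ^~ x) t| <=
  k.+3%:R / T * (timecut T k.+1 t * logcut N.+1%:R^-1 k.+1 x).
Proof.
move=> T0 t0.
have D : is_derive t 1 (log_test T N k.+3 ^~ x)
    (dtimecut T k.+3 t * logcut N.+1%:R^-1 k.+3 x).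
  have ? := is_derive_timecut T k.+1 t.
  rewrite (_ : log_test T N k.+3 ^~ x =
    timecut T k.+3 * cst (logcut N.+1%:R^-1 k.+3 x))//.
  by apply: is_derive_eq; rewrite /GRing.scale/= mulr0 add0r mulrC.
rewrite derive1E derive_val /dtimecut normrM normrM normrN.
have b0 : 0 <= k.+3%:R / T by rewrite divr_ge0// ltW.
rewrite (ger0_norm b0) -mulrA ler_wpM2l//.
rewrite (ger0_norm (pospow_ge0 _ _)) (ger0_norm (pospow_ge0 _ _)).
apply: ler_pM; [exact: pospow_ge0|exact: pospow_ge0| |].
  by apply: (@timecut_le _ _ k.+2).
by apply: (@logcut_le _ _ k.+3); rewrite ltnS leqW.
Qed.

Lemma log_test_sublaplacian m (a : 'I_m -> 'I_n -> 'rV[R]_n -> R) (M : R) T N k t x :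
  (forall l i, smooth (a l i)) ->
  (forall l i y, `|a l i y| <= M) ->
  (forall l i j y, `|partial i (a l j) y| <= M) -> 0 < T -> 0 <= t ->
  `|sublaplacian a (log_test T N k.+3 t) x| <=
  (3 * m * n ^ 2)%:R * M ^+ 2 * (4 * k.+4%:R ^+ 2) * N.+1%:R^-1 *
  (Num.sqrt (1 + sqnorm x))^-1 *
  (timecut T k.+1 t * logcut N.+1%:R^-1 k.+1 x).
Proof.
move=> sa aM daM T0 t0.
have [D1 D2] := continuously_differentiable2W (logcut_C2 N.+1%:R^-1 k).
have e0 : 0 <= timecut T k.+3 t by exact: pospow_ge0.
have et := timecut_le T0 t0 (leqW (leqnSn k.+1)).
set B := 4 * k.+4%:R ^+ 2 * N.+1%:R^-1 * (Num.sqrt (1 + sqnorm x))^-1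
    * logcut N.+1%:R^-1 k.+1 x.
have B1 i : `|partial i (logcut N.+1%:R^-1 k.+3) x| <= B.
  by rewrite partial_logcut; exact: norm_dlogcut.
have B2 i j : `|partial i (partial j (logcut N.+1%:R^-1 k.+3)) x| <= B.
  by rewrite partial_logcut partial_dlogcut; exact: norm_ddlogcut.
have pZ i : partial i (log_test T N k.+3 t) =
    (fun y => timecut T k.+3 t * partial i (logcut N.+1%:R^-1 k.+3) y).
  by apply: partialZ => y; exact: D1.
have [_ D2'] := continuously_differentiable2W
  (continuously_differentiableZ (timecut T k.+3 t) (logcut_C2 N.+1%:R^-1 k)).
have -> : (3 * m * n ^ 2)%:R * M ^+ 2 * (4 * k.+4%:R ^+ 2) * N.+1%:R^-1 *
    (Num.sqrt (1 + sqnorm x))^-1 *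
    (timecut T k.+1 t * logcut N.+1%:R^-1 k.+1 x) =
    (3 * m * n ^ 2)%:R * M ^+ 2 * (timecut T k.+1 t * B).
  by rewrite /B; ring.
apply: norm_sublaplacian_le => //.
- move=> l i j.
  by have [+ _] := continuously_differentiable2W (sa l i 2%N); apply.
- by move=> i; rewrite pZ normrM (ger0_norm e0); apply: ler_pM.
- move=> i j; rewrite pZ partialZ; last by move=> y; exact: D2.
  by rewrite normrM (ger0_norm e0); apply: ler_pM.
Qed.

Lemma measurable_timecut T k : measurable_fun setT (timecut T k).
Proof.
apply: measurable_funX; apply: measurable_maxr => //.
by apply: measurable_funB => //; exact: measurable_funM.
Qed.

Lemma measurable_log_test T N k :
  measurable_fun setT (fun z : R * 'rV[R]_n => log_test T N k z.1 z.2).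
Proof.
apply: measurable_funM.
  by apply: measurableT_comp => //; exact: measurable_timecut.
by apply: measurableT_comp => //; exact: measurable_logcut.
Qed.

End test_function.

(** * Balance of the weak formulation and the contradiction *)

Section no_global_solution.
Context {R : realType} {n m : nat}.
Variables (f u0 : 'rV[R]_n.+1 -> R) (a : 'I_m -> 'I_n.+1 -> 'rV[R]_n.+1 -> R).
Variable (M : R).
Hypotheses (n1 : (1 < n)%N) (sa : forall l i, smooth (a l i)).
Hypotheses (aM : forall l i x, `|a l i x| <= M).
Hypotheses (daM : forall l i j x, `|partial i (a l j) x| <= M).
Hypotheses (mf : measurable_fun setT f) (mu0 : measurable_fun setT u0).
Hypothesis u0_ge0 : {ae @lebesgue_rV R n.+1, forall x, 0 <= u0 x}.

Local Notation p := (n.+1%:R / n%:R : R).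
(** The dimension is [n.+1], so the exponent q of the overview is [k.+3], and q - 2 = 2 n is
    [k.+1]. *)
Let k := (2 * n).-1.

Let kS : k.+1 = (2 * n)%N. Proof. by rewrite /k; lia. Qed.
Let kSSS : k.+3 = (2 * n.+1)%N. Proof. by rewrite /k; lia. Qed.

Let C : R := (3 * m * n.+1 ^ 2)%:R * M ^+ 2 * (4 * k.+4%:R ^+ 2).

Let C0 : 0 <= C.
Proof. by rewrite mulr_ge0// mulr_ge0// exprn_even_ge0. Qed.

(** This and [space_remainder] are what Young's inequality leaves of the psi_t and Delta_X psi
    terms, per unit of time: the power of the coefficient times the volume of the supporting cube,
    respectively the mass of [log_weight]. *)
Definition time_remainder (N : nat) (T : R) : R :=
  (2 * (k.+3%:R / T)) ^+ n.+1 * (2 * expR (N.+1%:R / 2)) ^+ n.+1.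

Definition space_remainder (N : nat) : R :=
  (2 * (C * N.+1%:R^-1)) ^+ n.+1 * (N.+1%:R * (2 * expR 2^-1) ^+ n.+1).

Lemma weak_solution_balance (u : R -> 'rV[R]_n.+1 -> R) (N : nat) (T r : R) :
  0 < T -> 0 <= r ->
  (forall c, 0 <= c -> ((c * r)%:E <=
    \int[@lebesgue_rV R n.+1]_x (f x * (c * logcut N.+1%:R^-1 k.+3 x))%:E)%E) ->
  weak_solution a p f u0 +oo u ->
  r / 2 ^+ k.+4 <= time_remainder N T + space_remainder N.
Proof.
move=> T0 r0 fr [[mu _]] /(_ (log_test T N k.+3)) Hu.
have {Hu} := Hu (log_test_C1c_C2c N k T0) (fun t x _ => log_test_ge0 T N k.+3 t x).
move=> bal.
(* Forcing and remainders are all taken over a time of order T, a common factor that is divided out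
   here. *)
suff : r * (T / 2 ^+ k.+4) <= time_remainder N T * T + space_remainder N * T.
  by rewrite -mulrDl mulrCA mulrC ler_pM2r.
have psi0 t x : 0 <= log_test T N k.+3 t x by exact: log_test_ge0.
have ma : measurable_fun (Ioo0 +oo `*` [set: 'rV[R]_n.+1])
    (fun z => `|u z.1 z.2| `^ p * log_test T N k.+3 z.1 z.2).
  apply: measurable_funM; last first.
    by apply: measurable_funTS; exact: measurable_log_test.
  apply: (@measurableT_comp _ _ _ _ _ _ (fun s : R => s `^ p)) => //.
  exact: measurableT_comp.
have a0 t x : 0 < t -> 0 <= `|u t x| `^ p * log_test T N k.+3 t x.
  by move=> _; rewrite mulr_ge0// powR_ge0.
have wE t : (0 < 1 - T^-1 * t) = (t < T).
  by rewrite subr_gt0 ltr_pdivrMl// mulr1.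
have Y t x (b c : R) : 0 <= b ->
    `|c| <= b * (timecut T k.+1 t * logcut N.+1%:R^-1 k.+1 x) ->
    `|u t x * c| <= 2^-1 * (`|u t x| `^ p * log_test T N k.+3 t x)
      + (2 * b) ^+ n.+1 * ((t < T) && (0 < logw N.+1%:R^-1 x))%:R.
  rewrite -wE /log_test /timecut /logcut kSSS kS.
  by apply: young_cutoff; exact: ltnW.
apply: le_of_balance bal.
- apply: integral_ge0 => t _; apply: integral_ge0 => x _.
  by rewrite lee_fin mulr_ge0// powR_ge0.
- apply: integral_mul_ge0 => //.
  apply: measurable_funM => //; exact: measurable_logcut.
- by rewrite mulr_ge0// divr_ge0// ltW.
- have mt : measurable_fun (Ioo0 +oo : set R)
      (fun t => (timecut T k.+3 t)%:E : \bar R).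
    by apply: measurable_funTS; apply/measurable_EFinP; exact: measurable_timecut.
  apply: (@le_trans _ _ (\int[@lebesgue_measure R]_(t in Ioo0 +oo)
      (r%:E * (timecut T k.+3 t)%:E))%E).
    rewrite ge0_integralZl_EFin//.
    + by rewrite EFinM lee_wpmul2l// integral_timecut_ge.
    + exact: measurable_Ioo0y.
    + by move=> t _; rewrite lee_fin pospow_ge0.
  apply: ge0_subset_integral_le => t _.
    by rewrite -EFinM lee_fin mulr_ge0// pospow_ge0.
  (* At a fixed time the time cut-off is a nonnegative constant, which takes the place of [c] in the
     bound on the forcing. *)
  rewrite -EFinM mulrC; apply: fr; exact: pospow_ge0.
- have b0 : 0 <= k.+3%:R / T by rewrite divr_ge0// ltW.
  (* For psi_t the coefficient is constant in x, and the majorant is constant on the cube containing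
     the support. *)
  apply: (iterated_integral_ge ma a0 (V := fun x =>
    (2 * (k.+3%:R / T)) ^+ n.+1 * \1_(cube (expR (N.+1%:R / 2))) x)) => //.
  + apply: measurable_funM => //; apply: measurable_indic; exact: measurable_cube.
  + by move=> x; rewrite mulr_ge0// exprn_ge0// mulr_ge0.
  + under eq_integral do rewrite EFinM.
    rewrite ge0_integralZl_EFin ?exprn_ge0 ?mulr_ge0 ?invr_ge0 ?(ltW T0)//; last first.
      by apply/measurable_EFinP/measurable_indic; exact: measurable_cube.
    rewrite integral_indic//; last exact: measurable_cube.
    by rewrite setIT [X in (_ * X)%E]lebesgue_rV_cube ?expR_ge0.
  + move=> t x t0.
    apply: (le_trans (Y t x _ _ b0 (log_test_derive1 N k x T0 (ltW t0)))).
    rewrite lerD2l -mulrA; apply: ler_wpM2l; first by rewrite exprn_ge0// mulr_ge0.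
    have [tT|tT] := ltP t T; last by rewrite mulr0.
    rewrite mulr1 /=; have [w0|w0] := ltP 0 (logw _ x) => //.
    by rewrite indicE mem_set//; exact: logw_gt0_cube.
- have bC : 0 <= C * N.+1%:R^-1 by apply: (mulr_ge0 C0); rewrite invr_ge0.
  have bC2 : 0 <= (2 * (C * N.+1%:R^-1)) ^+ n.+1.
    by apply: exprn_ge0; apply: mulr_ge0 bC.
  (* For Delta_X psi the coefficient contains (1 + |x|^2)^(-1/2), whose power [n.+1] is dominated by
     [log_weight] where the cut-off is positive. *)
  apply: (iterated_integral_ge ma a0 (V := fun x =>
    (2 * (C * N.+1%:R^-1)) ^+ n.+1 * log_weight N.+1 x)) => //.
  + apply: measurable_funM => //; exact: measurable_log_weight.
  + by move=> x; apply: (mulr_ge0 bC2); exact: log_weight_ge0.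
  + under eq_integral do rewrite EFinM.
    rewrite ge0_integralZl_EFin//; last 2 first.
    * by move=> x _; rewrite lee_fin log_weight_ge0.
    * by apply/measurable_EFinP; exact: measurable_log_weight.
    by rewrite integral_log_weight.
  + move=> t x t0; set S := (Num.sqrt (1 + sqnorm x))^-1.
    have S0 : 0 <= S by rewrite invr_ge0 sqrtr_ge0.
    have bS0 : 0 <= C * N.+1%:R^-1 * S by exact: mulr_ge0 bC S0.
    apply: (le_trans (Y t x _ _ bS0
      (log_test_sublaplacian N k x sa aM daM T0 (ltW t0)))).
    rewrite lerD2l (mulrA 2 _ S) exprMn.
    rewrite -(mulrA _ (S ^+ n.+1)) -(mulrA _ (log_weight N.+1 x)).
    apply: (ler_wpM2l bC2).
    have [tT|tT] := ltP t T; last by rewrite !mulr0.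
    rewrite mulr1 /=; have [w0|w0] := ltP 0 (logw _ x).
      by rewrite mulr1; exact: le_log_weight.
    by rewrite mulr0 log_weight_ge0.
Qed.

Let K : R := (2 * C) ^+ n.+1 * (2 * expR 2^-1) ^+ n.+1.

Let K0 : 0 <= K.
Proof.
by apply: mulr_ge0; apply: exprn_ge0; apply: mulr_ge0 => //; exact: expR_ge0.
Qed.

(** Of the [n.+1] factors 1 / (N + 1), one cancels the mass of the weight; since [n] is positive, at
    least one more is left. *)
Lemma space_remainder_le N : space_remainder N <= K * N.+1%:R^-1.
Proof.
have N0 : N.+1%:R != 0 :> R by [].
rewrite /space_remainder /K; set d := N.+1%:R^-1 : R.
rewrite (mulrA 2 C d) (exprMn _ _ d) (exprSr d).
have -> : (2 * C) ^+ n.+1 * (d ^+ n * d) * (N.+1%:R * (2 * expR 2^-1) ^+ n.+1) =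
    (2 * C) ^+ n.+1 * (2 * expR 2^-1) ^+ n.+1 * d ^+ n * (d * N.+1%:R) by ring.
rewrite mulVf// mulr1; apply: ler_wpM2l.
  exact: K0.
rewrite -[leRHS]expr1; apply: ler_wiXn2l; rewrite /d ?invr_ge0//.
  by rewrite invf_le1 ?ltr0Sn// ler1n.
exact: ltnW.
Qed.

Lemma time_remainder_le N T : 1 <= T ->
  time_remainder N T <=
  (2 * k.+3%:R) ^+ n.+1 * (2 * expR (N.+1%:R / 2)) ^+ n.+1 / T.
Proof.
move=> T1; have T0 : 0 < T by exact: lt_le_trans T1.
rewrite /time_remainder (mulrA 2 _ T^-1) (exprMn _ _ T^-1) mulrAC.
apply: ler_wpM2l.
  by rewrite mulr_ge0// exprn_ge0 ?mulr_ge0 ?expR_ge0.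
rewrite -[leRHS]expr1; apply: ler_wiXn2l; rewrite ?invr_ge0 ?(ltW T0)//.
by rewrite invf_le1.
Qed.

Lemma no_global_weak_solution :
  (0 < \int[@lebesgue_rV R n.+1]_x (f x)%:E)%E ->
  ~ exists u, global_weak_solution a p f u0 u.
Proof.
move=> fpos [u Hu].
have i0 N : 0 <= N.+1%:R^-1 :> R by rewrite invr_ge0.
have [r r0 Hr] := integral_mul_cutoff_ge mf
  (fun N => measurable_logcut N.+1%:R^-1 k.+3)
  (fun N x => logcut_ge0_le1 k.+3 x (i0 N))
  (nondecreasing_logcut k.+3) (cvg_logcut k.+3) fpos.
set c := r / 2 ^+ k.+4.
have c0 : 0 < c by rewrite divr_gt0// exprn_gt0.
(* The constant [c] depends on neither N nor T. First N makes the space remainder less than c / 2;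
   then T, depending on N, does so for the time remainder. *)
near \oo => N.
have fr : forall s, 0 <= s -> ((s * r)%:E <=
    \int[@lebesgue_rV R n.+1]_x (f x * (s * logcut N.+1%:R^-1 k.+3 x))%:E)%E.
  by near: N.
have KN : K * N.+1%:R^-1 < c / 2.
  rewrite ltr_pdivrMr ?ltr0Sn// mulrC -ltr_pdivrMr ?divr_gt0//.
  apply: (@lt_trans _ _ N%:R); last by rewrite ltr_nat.
  by near: N; exact: nbhs_infty_gtr.
set Q := (2 * k.+3%:R) ^+ n.+1 * (2 * expR (N.+1%:R / 2)) ^+ n.+1 : R.
have Q0 : 0 <= Q by rewrite mulr_ge0// exprn_ge0 ?mulr_ge0 ?expR_ge0.
(* With this choice (c / 2) T = c / 2 + Q exceeds Q, and T is at least 1 as [time_remainder_le]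
   requires. *)
pose T := 1 + 2 * Q / c.
have T1 : 1 <= T by rewrite lerDl; apply: divr_ge0; [exact: mulr_ge0|exact: ltW].
have T0 : 0 < T by exact: lt_le_trans T1.
have QT : Q / T < c / 2.
  rewrite ltr_pdivrMr// /T.
  have -> : c / 2 * (1 + 2 * Q / c) = c / 2 + Q by field; rewrite gt_eqF.
  by rewrite ltrDr divr_gt0.
suff : c < c by rewrite ltxx.
rewrite [ltRHS]splitr.
apply: (le_lt_trans (weak_solution_balance T0 (ltW r0) fr Hu)); apply: ltrD.
  exact: le_lt_trans (time_remainder_le N T1) QT.
exact: le_lt_trans (space_remainder_le N) KN.
Unshelve. all: by end_near. Qed.

End no_global_solution.

Theorem theorem3p4 (R : realType) (n m : nat)
    (f u0 : 'rV[R]_n -> R) (a : 'I_m -> 'I_n -> 'rV[R]_n -> R)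
    (hn : (2 < n)%N)
    (hf : L1loc f) (hu0 : L1loc u0)
    (hu0_ge0 : {ae @lebesgue_rV R n, forall x, 0 <= u0 x})
    (ha : forall k i, smooth (a k i))
    (hf_pos : (0 < \int[@lebesgue_rV R n]_x (f x)%:E)%E)
    (ha_bnd : forall k i, bounded_fun (a k i))
    (hda_bnd : forall k i j, bounded_fun (partial i (a k j))) :
  ~ exists u : R -> 'rV[R]_n -> R,
      global_weak_solution a (n%:R / (n%:R - 1)) f u0 u.
Proof.
case: n f u0 a hn hf hu0 hu0_ge0 ha hf_pos ha_bnd hda_bnd => [//|n] f u0 a n1
  [mf _] [mu0 _] u0_ge0 sa fpos aB daB.
(* Finitely many bounded functions are involved, so one large M bounds them all. *)
near +oo_R => M.
have aM k i x : `|a k i x| <= M.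
  move: k i x; near: M.
  apply: filter_forall => k; apply: filter_forall => i.
  have : \forall r \near +oo, forall x, setT x -> `|a k i x| <= r := aB k i.
  by apply: filterS => r aM x; exact: aM.
have daM k i j x : `|partial i (a k j) x| <= M.
  move: k i j x; near: M.
  apply: filter_forall => k; apply: filter_forall => i; apply: filter_forall => j.
  have : \forall r \near +oo, forall x, setT x -> `|partial i (a k j) x| <= r
    := daB k i j.
  by apply: filterS => r daM x; exact: daM.
have -> : (n.+1%:R - 1 : R) = n%:R by rewrite -natr1 addrK.
exact: (no_global_weak_solution n1 sa aM daM mf mu0 u0_ge0 fpos).
Unshelve. all: by end_near. Qed.
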